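(* Let $0<q<1$ and $N\ge2$. $SU_q(N)$ has property (NC), hence (LK). That is: for each completely non-gaussian $*$-representation $\pi$ of $SU_q(N)$ and each $\pi$-$\varepsilon$-cocycle $\eta$ there exists a Schürmann triple $(\pi,\eta,\psi)$; and, consequently, every generating functional on $SU_q(N)$ admits a Lévy-Khintchine decomposition.
   Context: Fix $0<q<1$. $SU_q(N)$ is the unital complex algebra generated by $u_{jk}$ $(1\le j,k\le N)$ subject to: $u_{ij}u_{kj}=qu_{kj}u_{ij}$ for $i<k$; $u_{ij}u_{il}=qu_{il}u_{ij}$ for $j<l$; $u_{ij}u_{kl}=u_{kl}u_{ij}$ for $i<k,\ j>l$; $u_{ij}u_{kl}=u_{kl}u_{ij}-(q^{-1}-q)u_{il}u_{kj}$ for $i<k,\ j<l$; and $D=\mathbf 1$, where $D=\sum_{\sigma\in S_N}(-q)^{i(\sigma)}u_{1,\sigma(1)}\cdots u_{N,\sigma(N)}$ and $i(\sigma)$ is the number of inversions of $\sigma$. It is a $*$-algebra with $u_{jk}^*=(-q)^{k-j}D^{jk}$, where $D^{jk}$ is the quantum determinant (same formula, inversions counted with respect to the natural order of the remaining indices) of the matrix $(u_{il})$ with row $j$ and column $k$ removed. One has $\sum_su_{js}u_{ks}^*=\delta_{jk}\mathbf 1=\sum_su_{sj}^*u_{sk}$. The counit is the unital $*$-homomorphism $\varepsilon\colon SU_q(N)\to\mathbb C$, $\varepsilon(u_{jk})=\delta_{jk}$. Put $K_n=\mathrm{span}\,(\ker\varepsilon)^n$; $K_1=\ker\varepsilon$.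 A generating functional is a linear functional $\psi$ that is hermitian ($\psi(b^* )=\overline{\psi(b)}$), satisfies $\psi(\mathbf 1)=0$, and $\psi(b^*b)\ge0$ for $b\in K_1$. A $*$-representation is a unital $*$-homomorphism $\pi\colon SU_q(N)\to B(H)$ ($H=\{0\}$ allowed). A $\pi$-$\varepsilon$-cocycle is a linear map $\eta\colon SU_q(N)\to H$ with $\eta(ab)=\pi(a)\eta(b)+\eta(a)\varepsilon(b)$; it is cyclic if its range is dense. A Schürmann triple $(\pi,\eta,\psi)$ consists of a $*$-representation $\pi$, a $\pi$-$\varepsilon$-cocycle $\eta$ and a linear functional $\psi$ with $\langle\eta(a),\eta(b)\rangle=\psi(a^*b)-\psi(a^* )\varepsilon(b)-\varepsilon(a^* )\psi(b)$ for all $a,b$. Every generating functional $\psi$ belongs to a Schürmann triple with cyclic $\eta$, unique up to unitary equivalence ( *the* Schürmann triple of $\psi$). A representation is gaussian if it vanishes on $K_1$, and completely non-gaussian if $\{0\}$ is the only invariant subspace on which it restricts to a gaussian representation. Given $\psi$ with Schürmann triple $(\pi,\eta,\psi)$, split $\pi=\pi_G\oplus\pi_{NG}$ with $\pi_G$ the restriction to the maximal gaussian subspace $\bigcap_{a\in K_1}\ker\pi(a)$ and $\pi_{NG}$ the restriction to its orthogonal complement, and accordingly $\eta=\eta_G\oplus\eta_{NG}$. A Lévy-Khintchine decomposition of $\psi$ is $\psi=\psi_G+\psi_L$ with generating functionals $\psi_G,\psi_L$ such that $(\pi_G,\eta_G,\psi_G)$ and $(\pi_{NG},\eta_{NG},\psi_L)$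 are Schürmann triples. *)

(* Defs.v *)
From HB Require Import structures.
From mathcomp Require Import all_boot all_order all_algebra all_fingroup.
From mathcomp Require Import sesquilinear complex.
From mathcomp Require Import all_classical all_reals all_analysis.

Set Implicit Arguments.
Unset Strict Implicit.
Unset Printing Implicit Defensive.

Import Order.TTheory GRing.Theory Num.Theory.
Import numFieldNormedType.Exports.

Local Open Scope classical_set_scope.
Local Open Scope complex_scope.
Local Open Scope ring_scope.

Record hilbert (R : realType) := Hilbert {
  hilb_sort :> completeNormedModType R[i];
  hilb_dot : {dot hilb_sort for (@Num.conj R[i])};
  hilb_dotE : forall x, hilb_dot x x = `|x| ^+ 2
}.

(* [hilb_dot] is linear in its first argument, as in the library; [ip] is the
   same product with the arguments swapped, hence linear in the second one. *)
Definition ip (R : realType) (H : hilbert R) (x y : H) : R[i] :=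
  hilb_dot H y x.

Record closedSubspace (R : realType) (H : hilbert R) := ClosedSubspace {
  csub_set :> set H;
  csub_lin : csub_set 0 /\
    (forall (c : R[i]) x y, csub_set x -> csub_set y -> csub_set (c *: x + y));
  csub_closed : closed csub_set
}.

Section SubHilbert.
Variables (R : realType) (H : hilbert R) (S : closedSubspace H).

Definition csub_pred : {pred H} := fun x => `[< (S : set H) x >].

Lemma csub_predP x : reflect ((S : set H) x) (x \in csub_pred).
Proof. exact: asboolP. Qed.

Lemma csub_submod_closed : submod_closed csub_pred.
Proof.
have [S0 SD] := csub_lin S; split; first exact/csub_predP.
by move=> c x y /csub_predP Sx /csub_predP Sy; apply/csub_predP; apply: SD.
Qed.

HB.instance Definition _ :=
  GRing.isSubmodClosed.Build R[i] H csub_pred csub_submod_closed.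

Record csub_type := CSub { csub_val : H; _ : csub_val \in csub_pred }.

HB.instance Definition _ := [isSub for csub_val].
HB.instance Definition _ := [Choice of csub_type by <:].
HB.instance Definition _ := [SubChoice_isSubLmodule of csub_type by <:].

Lemma csub_val_linear : linear csub_val.
Proof. by move=> c x y; rewrite -[csub_val]/(\val : csub_type -> H) linearP. Qed.

Lemma csub_val_comb c x y : csub_val (c *: x + y) = c *: csub_val x + csub_val y.
Proof. exact: csub_val_linear. Qed.

HB.instance Definition _ :=
  GRing.isLinear.Build R[i] csub_type H *:%R csub_val csub_val_linear.

Lemma csub_valP (x : csub_type) : (S : set H) (csub_val x).
Proof. by case: x => x /= /csub_predP. Qed.

Definition csub_mk x (Sx : (S : set H) x) : csub_type :=
  CSub (introT (csub_predP x) Sx).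

Definition csub_norm (x : csub_type) : R[i] := `|csub_val x|.

Lemma csub_norm_triangle x y : csub_norm (x + y) <= csub_norm x + csub_norm y.
Proof. by rewrite /csub_norm raddfD; exact: ler_normD. Qed.

Lemma csub_normZ (c : R[i]) x : csub_norm (c *: x) = `|c| * csub_norm x.
Proof. by rewrite /csub_norm linearZ; exact: normrZ. Qed.

Lemma csub_norm0_eq0 x : csub_norm x = 0 -> x = 0.
Proof. by move=> /normr0_eq0 x0; apply: val_inj; rewrite /= x0 -[RHS]/(csub_val 0) raddf0. Qed.

HB.instance Definition _ := Lmodule_isNormed.Build R[i] csub_type
  csub_norm_triangle csub_normZ csub_norm0_eq0.

Lemma csub_ballE (x y : csub_type) e :
  ball x e y = ball (csub_val x) e (csub_val y).
Proof.
rewrite -!ball_normE /= /ball_/=.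
by rewrite -[LHS]/(is_true (csub_norm (x - y) < e)) /csub_norm raddfB.
Qed.

Lemma csub_cauchy_cvg (F : set_system csub_type) :
  ProperFilter F -> cauchy F -> cvg F.
Proof.
move=> FF Fc.
have Gc : cauchy (csub_val @ F).
  apply/cauchyP => e e0.
  have /cauchyP/(_ _ e0)[x Fx] := Fc.
  exists (csub_val x).
  suff xE : csub_val @^-1` ball (csub_val x) e = ball x e.
    by rewrite -xE in Fx.
  by apply/funext => y; rewrite /preimage/= csub_ballE.
have /cvg_ex[l Gl] : cvg (csub_val @ F) by exact: cauchy_cvg.
have Sl : (S : set H) l.
  apply: (@closed_cvg _ _ F _ csub_val (csub_set S) (@csub_closed _ _ S) _ l Gl).
  by apply: nearW; exact: csub_valP.
apply/cvg_ex; exists (csub_mk Sl); apply/cvg_ballP => e e0.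
move/cvg_ballP: Gl => /(_ e e0) Fl.
suff yE : ball (csub_mk Sl) e = csub_val @^-1` ball l e.
  have : F (csub_val @^-1` ball l e) by exact: Fl.
  by rewrite -yE.
by apply/funext => y; rewrite /preimage/= csub_ballE.
Qed.

HB.instance Definition _ :=
  Uniform_isComplete.Build csub_type csub_cauchy_cvg.

Definition csub_dot (x y : csub_type) : R[i] :=
  hilb_dot H (csub_val x) (csub_val y).

Lemma csub_dot_bilinear :
  bilinear_for (GRing.Scale.Law.clone _ _ *%R _)
    (GRing.Scale.Law.clone _ _ (Num.conj \; *%R) _) csub_dot.
Proof.
split=> x c y z; rewrite /csub_dot csub_val_comb.
  exact: linearPl.
exact: linearPr.
Qed.

HB.instance Definition _ := bilinear_isBilinear.Build R[i] csub_type csub_type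
  R[i] _ _ csub_dot csub_dot_bilinear.

Lemma csub_dot_hermitian x y :
  csub_dot x y = (-1) ^+ false * Num.conj (csub_dot y x).
Proof. exact: hermitian_subproof. Qed.

HB.instance Definition _ := isHermitianSesquilinear.Build R[i] csub_type
  false Num.conj csub_dot csub_dot_hermitian.

Lemma csub_dot_pos x : x != 0 -> 0 < csub_dot x x.
Proof.
move=> x0; apply: neq0_dnorm_gt0; apply: contra_neq x0 => x0.
by apply: val_inj; rewrite /= x0 -[RHS]/(csub_val 0) raddf0.
Qed.

HB.instance Definition _ := isDotProduct.Build R[i] csub_type csub_dot
  csub_dot_pos.

Definition subhilbert : hilbert R :=
  @Hilbert R csub_type csub_dot (fun x => hilb_dotE (csub_val x)).

Lemma subhilbert_comb (c : R[i]) (x y : subhilbert) :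
  csub_val (c *: x + y) = c *: csub_val x + csub_val y.
Proof. exact: csub_val_comb. Qed.

End SubHilbert.

Section OrthogonalComplement.
Variables (R : realType) (H : hilbert R).
Implicit Types x y : H.

Lemma ip_lin x c y z : ip x (c *: y + z) = c * ip x y + ip x z.
Proof. by rewrite /ip linearPl. Qed.

Lemma ip_conj x y : ip x y = Num.conj (ip y x).
Proof. by rewrite /ip [LHS]hermitian_subproof expr0 mul1r. Qed.

Lemma ip_norm x : ip x x = `|x| ^+ 2.
Proof. exact: hilb_dotE. Qed.

Lemma ip0 x : ip x 0 = 0.
Proof. by have := ip_lin x 1 0 0; rewrite !scale1r mul1r addr0 -[LHS]addr0 => /addrI. Qed.

Lemma ip_comb x c y d z : ip x (c *: y + d *: z) = c * ip x y + d * ip x z.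
Proof. by rewrite ip_lin -[d *: z]addr0 ip_lin ip0 addr0. Qed.

Lemma cauchy_schwarz x y : `|ip x y| <= `|x| * `|y|.
Proof.
have [->|x0] := eqVneq x 0; first by rewrite ip_conj ip0 conjC0 !normr0 mul0r.
have xp : 0 < ip x x by exact: neq0_dnorm_gt0.
pose z := ip x x *: y + (- ip x y) *: x.
have xz : ip x z = 0 by rewrite ip_comb mulNr mulrC subrr.
have zz : ip z z = ip x x * ip z y by rewrite {2}/z ip_comb (ip_conj z x) xz conjC0 mulr0 addr0.
have : 0 <= ip z y by rewrite -(pmulr_rge0 _ xp) -zz ip_norm exprn_ge0.
rewrite -conjC_ge0 -ip_conj /z ip_comb (ip_conj y x) mulNr.
rewrite -normCK subr_ge0 !ip_norm -exprMn.
by rewrite ler_pXn2r// nnegrE ?mulr_ge0.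
Qed.

Variable S : set H.

Definition ortho_set : set H := [set y | forall x, S x -> ip x y = 0].

Lemma ortho_lin : ortho_set 0 /\
  (forall (c : R[i]) x y, ortho_set x -> ortho_set y -> ortho_set (c *: x + y)).
Proof.
split=> [x _|c x y Sx Sy z Sz]; first exact: ip0.
by rewrite ip_lin Sx// Sy// mulr0 addr0.
Qed.

Lemma ortho_closed : closed ortho_set.
Proof.
move=> y cly x Sx; apply/eqP/negPn/negP => xy0.
have x0 : 0 < `|x|.
  rewrite normr_gt0; apply: contra_neq xy0 => ->.
  by rewrite ip_conj ip0 conjC0.
have e0 : 0 < `|ip x y| / `|x| by rewrite divr_gt0 // normr_gt0.
have [z [Oz yz]] := cly _ (nbhsx_ballx y _ e0).
have : `|ip x y| <= `|x| * `|y - z|.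
  have -> : ip x y = ip x (y - z).
    by rewrite addrC -scaleN1r ip_lin Oz// mulr0 add0r.
  exact: cauchy_schwarz.
rewrite lt_geF//.
by move: yz; rewrite -ball_normE /ball_/= ltr_pdivlMr// mulrC.
Qed.

Definition ortho : closedSubspace H := ClosedSubspace ortho_lin ortho_closed.

End OrthogonalComplement.

Record starAlg (R : realType) := StarAlg {
  salg :> algType R[i];
  star : salg -> salg;
  starD : forall a b, star (a + b) = star a + star b;
  starZ : forall (c : R[i]) a, star (c *: a) = Num.conj c *: star a;
  starM : forall a b, star (a * b) = star b * star a;
  starK : involutive star;
  counit : {lrmorphism salg -> R[i] | *%R};
  counit_star : forall a, counit (star a) = Num.conj (counit a)
}.

Section Representations.
Variables (R : realType) (A : starAlg R).

Record starRep (H : hilbert R) := StarRep {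
  rep :> A -> {linear H -> H};
  rep_cont : forall a, continuous (rep a);
  repP : forall (c : R[i]) a b x, rep (c *: a + b) x = c *: rep a x + rep b x;
  rep1 : forall x, rep 1 x = x;
  repM : forall a b x, rep (a * b) x = rep a (rep b x);
  rep_star : forall a x y, ip (rep (star a) x) y = ip x (rep a y)
}.

Definition K1 : set A := [set a | counit A a = 0].

Definition gaussian (H : hilbert R) (pi : starRep H) : Prop :=
  forall a, K1 a -> forall x, pi a x = 0.

Definition invariant_subspace (H : hilbert R) (pi : starRep H) (S : set H) : Prop :=
  forall a x, S x -> S (pi a x).

Section Restriction.
Variables (H : hilbert R) (pi : starRep H) (S : closedSubspace H).
Hypothesis invS : invariant_subspace pi S.

Definition restr_fun (a : A) (x : subhilbert S) : subhilbert S :=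
  csub_mk (invS a (csub_valP x)).

Lemma restr_linear a : linear (restr_fun a).
Proof.
move=> c x y; apply: val_inj.
rewrite /= -[RHS]/(csub_val (c *: restr_fun a x + restr_fun a y)).
by rewrite subhilbert_comb linearP.
Qed.

HB.instance Definition _ a := GRing.isLinear.Build R[i] (subhilbert S)
  (subhilbert S) *:%R (restr_fun a) (restr_linear a).

Lemma restr_cont a : continuous (restr_fun a).
Proof.
apply: (@bounded_linear_continuous _ (subhilbert S) (subhilbert S)
  (restr_fun a)).
apply/linear_boundedP.
have /linear_bounded_continuous/linear_boundedP := @rep_cont _ pi a.
by apply: filterS => r rB x; exact: (rB (csub_val x)).
Qed.

Lemma restrP (c : R[i]) a b x :
  restr_fun (c *: a + b) x = c *: restr_fun a x + restr_fun b x.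
Proof.
apply: val_inj.
rewrite /= -[RHS]/(csub_val (c *: restr_fun a x + restr_fun b x)).
by rewrite subhilbert_comb /= repP. Qed.

Lemma restr1 x : restr_fun 1 x = x.
Proof. by apply: val_inj; rewrite /= rep1. Qed.

Lemma restrM a b x : restr_fun (a * b) x = restr_fun a (restr_fun b x).
Proof. by apply: val_inj; rewrite /= repM. Qed.

Lemma restr_star a x y : ip (restr_fun (star a) x) y = ip x (restr_fun a y).
Proof. exact: (rep_star pi a (csub_val x) (csub_val y)). Qed.

Definition restr : starRep (subhilbert S) :=
  @StarRep (subhilbert S) (fun a => restr_fun a)
    restr_cont restrP restr1 restrM restr_star.

End Restriction.

Definition completely_nongaussian (H : hilbert R) (pi : starRep H) : Prop :=
  forall (S : closedSubspace H) (invS : invariant_subspace pi S),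
    gaussian (restr invS) -> (S : set H) = [set 0].

Section GaussianPart.
Variables (H : hilbert R) (pi : starRep H).

Definition gauss_set : set H := \bigcap_(a in K1) [set x | pi a x = 0].

Lemma gauss_lin : gauss_set 0 /\
  (forall (c : R[i]) x y, gauss_set x -> gauss_set y -> gauss_set (c *: x + y)).
Proof.
split=> [a _ /=|c x y Gx Gy a Ka /=]; first by rewrite linear0.
by rewrite linearP [pi a x]Gx// [pi a y]Gy// scaler0 addr0.
Qed.

Lemma gauss_closed : closed gauss_set.
Proof.
apply: closed_bigI => a _.
apply: (continuous_closedP _).1 [set 0] _; first exact: rep_cont.
apply: accessible_closed_set1; apply: hausdorff_accessible.
exact: norm_hausdorff.
Qed.

Definition gauss : closedSubspace H := ClosedSubspace gauss_lin gauss_closed.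

Lemma gauss_inv : invariant_subspace pi gauss.
Proof.
move=> a x Gx b Kb /=; rewrite -repM; apply: Gx.
by rewrite /K1/= rmorphM/= [counit A b]Kb mul0r.
Qed.

Lemma nongauss_inv : invariant_subspace pi (ortho gauss).
Proof.
move=> a x Ox y Gy; rewrite -rep_star; apply: Ox; exact: gauss_inv.
Qed.

Definition pi_G : starRep (subhilbert gauss) := restr gauss_inv.
Definition pi_NG : starRep (subhilbert (ortho gauss)) := restr nongauss_inv.

End GaussianPart.

Definition cocycle (H : hilbert R) (pi : starRep H)
    (eta : {linear A -> H}) : Prop :=
  forall a b, eta (a * b) = pi a (eta b) + counit A b *: eta a.

Definition cyclic (H : hilbert R) (eta : {linear A -> H}) : Prop :=
  dense (range eta).

Definition generating (psi : {scalar A}) : Prop :=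
  [/\ forall b, psi (star b) = Num.conj (psi b),
      psi 1 = 0
    & forall b, K1 b -> 0 <= psi (star b * b)].

Definition schurmann_triple (H : hilbert R) (pi : starRep H)
    (eta : {linear A -> H}) (psi : {scalar A}) : Prop :=
  cocycle pi eta /\
  forall a b, ip (eta a) (eta b) =
    psi (star a * b) - psi (star a) * counit A b - counit A (star a) * psi b.

(* The Schuermann triple of [psi] with cyclic cocycle is unique up to unitary
   equivalence, so it does not matter which one is taken. *)
Definition LK_decomposition (psi psiG psiL : {scalar A}) : Prop :=
  [/\ generating psiG, generating psiL, forall a, psi a = psiG a + psiL a
    & exists (H : hilbert R) (pi : starRep H) (eta : {linear A -> H}),
      [/\ schurmann_triple pi eta psi, cyclic eta
        & exists (etaG : {linear A -> subhilbert (gauss pi)})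
                 (etaNG : {linear A -> subhilbert (ortho (gauss pi))}),
          [/\ forall a, eta a = csub_val (etaG a) + csub_val (etaNG a),
              schurmann_triple (pi_G pi) etaG psiG
            & schurmann_triple (pi_NG pi) etaNG psiL]]].

Definition property_NC : Prop :=
  forall (H : hilbert R) (pi : starRep H), completely_nongaussian pi ->
  forall eta : {linear A -> H}, cocycle pi eta ->
  exists psi : {scalar A}, schurmann_triple pi eta psi.

Definition property_LK : Prop :=
  forall psi : {scalar A}, generating psi ->
  exists psiG psiL : {scalar A}, LK_decomposition psi psiG psiL.

End Representations.

Definition inversions N (s : 'S_N) : nat :=
  #|[pred p : 'I_N * 'I_N | (p.1 < p.2)%N && (s p.2 < s p.1)%N]|.

Definition qdet (R : realType) (q : R) (A : algType R[i]) N (u : 'M[A]_N) : A :=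
  \sum_(s : 'S_N) (- q%:C) ^+ inversions s *: \prod_(i < N) u i (s i).

Definition suq_relations (R : realType) (q : R) (A : algType R[i]) N
    (u : 'M[A]_N) : Prop :=
  [/\ forall i k j : 'I_N, (i < k)%N -> u i j * u k j = q%:C *: (u k j * u i j),
      forall i j l : 'I_N, (j < l)%N -> u i j * u i l = q%:C *: (u i l * u i j),
      forall i k j l : 'I_N, (i < k)%N -> (l < j)%N ->
        u i j * u k l = u k l * u i j,
      forall i k j l : 'I_N, (i < k)%N -> (j < l)%N ->
        u i j * u k l =
        u k l * u i j - (q%:C^-1 - q%:C) *: (u i l * u k j)
    & qdet q u = 1].

(* [A] is the algebra presented by the generators [u j k] and the relations
   above: it is pinned down, up to isomorphism, by its universal property. The
   star and the counit are then determined by their values on the generators.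
   The library's algebras being nonzero, so is [B]; this loses nothing. *)
Record is_SUq (R : realType) (q : R) N (A : starAlg R) (u : 'M[A]_N) : Prop := {
  suq_rel : suq_relations q u;
  suq_univ : forall (B : algType R[i]) (v : 'M[B]_N), suq_relations q v ->
    exists f : {lrmorphism A -> B}, map_mx f u = v /\
      forall g : {lrmorphism A -> B}, map_mx g u = v -> g =1 f;
  suq_star : forall j k : 'I_N,
    star (u j k) = (- q%:C) ^ (k%:Z - j%:Z) *: qdet q (row' j (col' k u));
  suq_counit : forall j k : 'I_N, counit A (u j k) = (j == k)%:R
}.

(* Main.v *)
(* For a cocycle eta that is a pointwise limit of coboundaries
   a |-> (pi a - eps a) v_n, the functionals psi_n a = <v_n, (pi a - eps a) v_n>
   complete the coboundaries to triples, and <eta a, eta b> is the limit of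
   psi_n (a^* b) - psi_n (a^* ) eps b - eps (a^* ) psi_n b. So psi_n converges on
   (ker eps)^2, and any linear extension of the limit is a functional for eta.

   Every cocycle of a completely non-gaussian representation is such a limit.
   Let t = pi u_mm, where m is the largest index such that u_jk does not act
   trivially as soon as max(j, k) = m. The space ker (1 - t) is reducing, u_jm and
   u_mj act on it as delta_jm, and eta vanishes there on all u_jm, u_mj: for j < m
   because of u_jm u_mm = q u_mm u_jm, and for j = m because eta u_mm is then
   invariant. One concludes by induction on m. On the orthogonal complement
   1 - t is injective and v_r = - (1 - r t)^-1 eta(u_mm) does it as r -> 1: the
   q-commutation with t turns u_jm v_r into a resolvent at r q < 1, which
   converges in norm, and for j, k < m the difference between
   (u_jk - delta_jk) v_r and eta u_jk is (1 - r) (1 - r t)^-1 applied to a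
   convergent family, which tends to 0 by the mean ergodic theorem.

   The decomposition of a generating functional follows by applying this to the
   non-gaussian part of its GNS triple. There the GNS operators are bounded
   because sum_s u_js u_js^* = 1, a quantum Laplace expansion of the determinant. *)
From HB Require Import structures.
From mathcomp Require Import all_boot all_order all_algebra all_fingroup.
From mathcomp Require Import sesquilinear complex.
From mathcomp Require Import all_classical all_reals all_analysis.
From mathcomp Require Import ring lra zify.
Require Import Defs.

Set Implicit Arguments.
Unset Strict Implicit.
Unset Printing Implicit Defensive.

Import Order.TTheory GRing.Theory Num.Theory.
Import numFieldNormedType.Exports.

Local Open Scope classical_set_scope.
Local Open Scope complex_scope.
Local Open Scope ring_scope.

(** * The algebra *)

(** A subset closed under the algebra operations is made an algebra type of its own, so that it can
    be a target of the universal property. *)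
Record subalg (K : nzRingType) (A : algType K) := Subalg {
  subalg_set :> A -> Prop;
  subalg1 : subalg_set 1;
  subalg_comb : forall (c : K) x y,
    subalg_set x -> subalg_set y -> subalg_set (c *: x + y);
  subalgM : forall x y, subalg_set x -> subalg_set y -> subalg_set (x * y)
}.

Section Subalgebra.
Variables (K : nzRingType) (A : algType K) (P : subalg A).

Definition subalg_pred : {pred A} := fun x => `[< P x >].

Lemma subalg_predP : subalg_closed subalg_pred.
Proof.
split; first exact/asboolP/subalg1.
- by move=> c x y /asboolP Px /asboolP Py; apply/asboolP; apply: subalg_comb.
- by move=> x y /asboolP Px /asboolP Py; apply/asboolP; apply: subalgM.
Qed.

HB.instance Definition _ :=
  GRing.isSubalgClosed.Build K A subalg_pred subalg_predP.

Record subalg_type := SubAlg { subalg_val : A; _ : subalg_val \in subalg_pred }.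

HB.instance Definition _ := [isSub for subalg_val].
HB.instance Definition _ := [Choice of subalg_type by <:].
HB.instance Definition _ := [SubChoice_isSubAlgebra of subalg_type by <:].

Lemma subalg_val_linear : linear subalg_val.
Proof. exact: (linearP (\val : subalg_type -> A)). Qed.

HB.instance Definition _ :=
  GRing.isLinear.Build K subalg_type A *:%R subalg_val subalg_val_linear.

Lemma subalg_val_monoid : monoid_morphism subalg_val.
Proof.
split; first exact: (rmorph1 (\val : subalg_type -> A)).
exact: (rmorphM (\val : subalg_type -> A)).
Qed.

HB.instance Definition _ :=
  GRing.isMonoidMorphism.Build subalg_type A subalg_val subalg_val_monoid.

Definition subalg_mk x (Px : P x) : subalg_type := SubAlg (asboolT Px).

End Subalgebra.

(** The universal property yields a map into the subalgebra of elements satisfying [P]. Followed by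
    the inclusion it fixes the generators, so by uniqueness it is the identity. *)
Lemma suq_ind (R : realType) (q : R) N (A : starAlg R) (u : 'M[A]_N)
    (P : A -> Prop) : is_SUq q u ->
  P 1 -> (forall (c : R[i]) x y, P x -> P y -> P (c *: x + y)) ->
  (forall x y, P x -> P y -> P (x * y)) -> (forall j k, P (u j k)) ->
  forall a, P a.
Proof.
move=> hA P1 PD PM Pu a.
pose S := Subalg P1 PD PM.
pose v : 'M[subalg_type S]_N := \matrix_(j, k) subalg_mk (Pu j k : S (u j k)).
have [r1 r2 r3 r4 r5] := suq_rel hA.
have valM (x y : subalg_type S) : \val (x * y) = \val x * \val y by exact: rmorphM.
have valZ c (x : subalg_type S) : \val (c *: x) = c *: \val x by exact: linearZ.
have valB (x y : subalg_type S) : \val (x - y) = \val x - \val y by exact: raddfB.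
have vv : suq_relations q v.
  split.
  - by move=> i k j ik; apply: val_inj; rewrite !mxE !(valM, valZ)/= r1.
  - by move=> i k j ik; apply: val_inj; rewrite !mxE !(valM, valZ)/= r2.
  - by move=> i k j l ik lj; apply: val_inj; rewrite !mxE !(valM, valZ)/= r3.
  - move=> i k j l ik lj; apply: val_inj.
    by rewrite !mxE !(valB, valM, valZ)/= (r4 i k j l).
  - apply: val_inj; rewrite [RHS](rmorph1 _) -[RHS]r5 /qdet raddf_sum.
    apply: eq_bigr => s _; apply: etrans (valZ _ _) _; congr (_ *: _).
    rewrite rmorph_prod.
    by apply: eq_bigr => i _; rewrite mxE.
have [f [fu _]] := suq_univ hA vv.
have [g [_ gE]] := suq_univ hA (suq_rel hA).
pose h : {lrmorphism A -> A} := @subalg_val _ _ S \o f.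
have hu : map_mx h u = u.
  by apply/matrixP => j k; move/matrixP: fu => /(_ j k); rewrite !mxE /= => ->.
have iu : map_mx (idfun : {lrmorphism A -> A}) u = u.
  by apply/matrixP => j k; rewrite mxE.
have <- : h a = a by rewrite (gE _ hu) -(gE _ iu).
by have /asboolP := valP (f a).
Qed.

(** * Inversions, quantum determinants and the Laplace expansion *)

Lemma sum_ord_lt n (j : 'I_n.+1) : (\sum_(k < n) (k < j))%N = j.
Proof.
have le : (j <= n)%N by rewrite -ltnS.
by rewrite -big_mkcond/= -(big_ord_widen _ (fun=> 1%N) le) sum1_card card_ord.
Qed.

(** The row [ord0], sent to [j], forms an inversion with each of the [j] rows whose value is
    smaller; lifting preserves the order, so the remaining pairs are those of [s]. *)
Lemma inversions_lift n (j : 'I_n.+1) (s : 'S_n) :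
  inversions (lift_perm ord0 j s) = (j + inversions s)%N.
Proof.
have invE m (t : 'S_m) :
    inversions t = (\sum_(a < m) \sum_(b < m) ((a < b) && (t b < t a)))%N.
  by rewrite /inversions -sum1_card big_mkcond/= pair_big/=.
rewrite !invE big_ord_recl big_ord_recl/= add0n lift_perm_id; congr addn.
  rewrite (reindex_inj (@perm_inj _ (s^-1)%g))/= -[RHS]sum_ord_lt.
  apply: eq_bigr => b _; rewrite lift_perm_lift permKV /=.
  by rewrite /bump; case: leqP => /= h; lia.
apply: eq_bigr => a _; rewrite big_ord_recl /= add0n.
apply: eq_bigr => b _; rewrite !lift_perm_lift /=.
by congr (nat_of_bool (_ && _)); rewrite /bump; do 2!case: leqP; lia.
Qed.

(* [(s, lift s i)] runs over the pairs of distinct indices; up to a swap they are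
   the pairs [c < e + 1] with [c <= e]. *)
Lemma sum_pairs (V : nmodType) n (F : 'I_n.+1 -> 'I_n -> V) :
  \sum_s \sum_i F s i =
  \sum_(e < n) \sum_(c < n | (c <= e)%N)
    (F (widen_ord (leqnSn n) c) e + F (lift ord0 e) c).
Proof.
under [RHS]eq_bigr do rewrite big_split/=.
rewrite [RHS]big_split/=.
have split_s (s : 'I_n.+1) : \sum_i F s i =
    \sum_(i < n | (s <= i)%N) F s i + \sum_(i < n | (i < s)%N) F s i.
  rewrite (bigID (fun i : 'I_n => (s <= i)%N))/=; congr +%R.
  by apply: eq_bigl => i; rewrite -ltnNge.
rewrite (eq_bigr _ (fun s _ => split_s s)) big_split/=; congr +%R; last first.
  by rewrite big_ord_recl big_pred0 ?add0r.
rewrite (exchange_big_dep predT)//=; apply: eq_bigr => e _.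
rewrite big_mkcond big_ord_recr /= leqNgt ltn_ord /= addr0.
by rewrite [RHS]big_mkcond.
Qed.

Section Laplace.
Variables (R : realType) (q : R) (A : algType R[i]).
Local Notation p := (- q%:C).

Lemma qdet_expand n (M : 'M[A]_n.+1) :
  qdet q M = \sum_(j < n.+1) p ^+ j *: (M ord0 j * qdet q (row' ord0 (col' j M))).
Proof.
rewrite /qdet (partition_big (fun s : 'S_n.+1 => s ord0) predT)//=.
apply: eq_bigr => j _; rewrite mulr_sumr scaler_sumr.
rewrite (reindex (lift_perm ord0 j)); last first.
  (* The inverse of [lift_perm ord0 j] deletes the point [ord0] and its value. *)
  pose ulsf (s : 'S_n.+1) k := odflt k (unlift (s ord0) (s (lift ord0 k))).
  have ulsfK (s : 'S_n.+1) k : lift (s ord0) (ulsf s k) = s (lift ord0 k).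
    by rewrite /ulsf; have [k' /= ->|/perm_inj/eqP] := unliftP; rewrite ?(eq_sym _ ord0) ?neq_lift.
  have inj_ulsf (s : 'S_n.+1) : injective (ulsf s).
    by move=> x y e; apply/(@lift_inj _ ord0)/(@perm_inj _ s); rewrite -!ulsfK e.
  exists (fun s => perm (inj_ulsf s)) => [s _ | s].
    by apply/permP=> k'; rewrite permE /ulsf lift_perm_lift lift_perm_id liftK.
  rewrite unfold_in => /eqP<-; apply/permP => k.
  by have [k' ->|->] := unliftP ord0 k; rewrite ?lift_perm_id // lift_perm_lift permE ulsfK.
rewrite (eq_bigl predT) => [|s]; last by rewrite lift_perm_id eqxx.
apply: eq_bigr => s _; rewrite inversions_lift exprD -scalerA -scalerAr.
congr (_ *: (_ *: _)); rewrite big_ord_recl lift_perm_id; congr (_ * _).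
by apply: eq_bigr => i _; rewrite lift_perm_lift !mxE.
Qed.

(* [x] stands for the row of smaller index; this is the only consequence of the
   relations of SU_q(N) that the Laplace expansion uses. *)
Definition qrows n (x y : 'I_n -> A) := forall c d : 'I_n, (c < d)%N ->
  y c * x d + p *: (y d * x c) = p *: (x c * y d + p *: (x d * y c)).

(** Induction on the size. On the left the minors are expanded along the first row; on the right the
    determinant is expanded along its first row and the minors along row [j] by induction. Both
    sides run over pairs of columns with the same remaining minors, and [qrows] compares the two
    terms of each pair. *)
Lemma qdet_laplace n (M : 'M[A]_n) (j : 'I_n) :
  (forall i : 'I_n, (i < j)%N -> qrows (M i) (M j)) ->
  \sum_(s < n) p ^+ s *: (M j s * qdet q (row' j (col' s M))) = p ^+ j *: qdet q M.
Proof.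
elim: n => [|n IH] in M j *; first by case: j.
have [j'|] := unliftP ord0 j; last first.
  by move=> -> _; rewrite qdet_expand expr0 scale1r.
case: n => [|n] in M j j' IH *; first by case: j'.
move=> jE rel; rewrite (qdet_expand M) scaler_sumr.
pose Q s i := qdet q (row' ord0 (col' i (row' j (col' s M)))).
transitivity (\sum_(s < n.+2) \sum_(i < n.+1)
      p ^+ (s + i) *: (M j s * M ord0 (lift s i) * Q s i)).
  apply: eq_bigr => s _; rewrite qdet_expand mulr_sumr scaler_sumr.
  apply: eq_bigr => i _; rewrite -scalerAr scalerA -exprD mulrA !mxE.
  by congr (_ *: (_ * M _ _ * _)); apply: val_inj; rewrite jE.
pose Q' i s := qdet q (row' j' (col' s (row' ord0 (col' i M)))).
transitivity (p *: \sum_(i < n.+2) \sum_(s < n.+1)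
    p ^+ (i + s) *: (M ord0 i * M j (lift i s) * Q' i s)); last first.
  rewrite scaler_sumr; apply: eq_bigr => i _; rewrite scalerA -exprD addnC.
  rewrite jE lift0 addnS exprS -scalerA; congr (_ *: _).
  rewrite exprD -scalerA scalerAr -IH; last first.
    move=> k kj c d cd; rewrite !mxE -jE.
    apply: (rel (lift ord0 k) _ (lift i c) (lift i d)); first by rewrite jE.
    by rewrite /= /bump; lia.
  rewrite mulr_sumr scaler_sumr; apply: eq_bigr => s _.
  by rewrite -scalerAr scalerA -exprD mulrA !mxE.
(* Each pair of columns [c' < d] occurs in its two orderings on either side. Their exponents differ
   by one, which accounts for the inner factor [p] in [qrows]. *)
rewrite !sum_pairs scaler_sumr; apply: eq_bigr => e _.
rewrite scaler_sumr; apply: eq_bigr => c ce.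
set c' := widen_ord _ c; set d := lift ord0 e.
have cd : (c' < d)%N by rewrite /= /bump/= add1n ltnS.
have -> : lift c' e = d by apply: val_inj; rewrite /= /bump /= ce.
have -> : lift d c = c' by apply: val_inj; rewrite /= /bump/=; lia.
have rows a : lift j (lift ord0 a) = lift ord0 (lift j' a).
  by apply: val_inj; rewrite jE /= /bump /=; lia.
have cols b : lift d (lift c b) = lift c' (lift e b).
  by apply: val_inj; rewrite /= /bump /=; lia.
have Q1 : Q d c = Q c' e by congr qdet; apply/matrixP => a b; rewrite !mxE cols.
have Q2 : Q' c' e = Q c' e by congr qdet; apply/matrixP => a b; rewrite !mxE rows.
have Q3 : Q' d c = Q c' e.
  by congr qdet; apply/matrixP => a b; rewrite !mxE rows cols.
rewrite Q1 Q2 Q3; have -> : (d + c)%N = (c' + e).+1 by rewrite lift0 addSn addnC.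
rewrite exprSr -!scalerA -!scalerDr [RHS]scalerA mulrC -scalerA; congr (_ *: _).
have j0 : ((ord0 : 'I_n.+2) < j)%N by rewrite jE.
have := congr1 (fun z => z * Q c' e) (rel ord0 j0 c' d cd).
by rewrite mulrDl -!scalerAl mulrDl -!scalerAl.
Qed.

End Laplace.

Lemma suq_unitary (R : realType) (q : R) N (A : starAlg R) (u : 'M[A]_N) j :
  0 < q < 1 -> is_SUq q u -> \sum_(s < N) u j s * star (u j s) = 1.
Proof.
move=> /andP[q0 _] hA; have [r1 r2 r3 r4 r5] := suq_rel hA.
have p0 : - q%:C != 0 :> R[i] by rewrite oppr_eq0 (inj_eq (@complexI _)) gt_eqF.
(* After reordering by the third and fourth relations the coefficients agree because q (q^-1 - q) +
   q^2 = 1. *)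
have rel : forall i : 'I_N, (i < j)%N -> qrows q (u i) (u j).
  move=> i ij c d cd; rewrite (r4 i j c d)// -(r3 i j d c)//.
  rewrite -addrA -scaleNr -scalerDl scalerDr scalerA addrC.
  rewrite [X in _ = _ + X *: _](_ : _ = 1) ?scale1r//.
  by field; rewrite -oppr_eq0.
have := qdet_laplace rel; rewrite r5 => /(congr1 ( *:%R (((- q%:C) ^+ j)^-1))).
rewrite scalerA mulVf ?expf_neq0// scale1r => <-.
rewrite scaler_sumr; apply: eq_bigr => s _; rewrite (suq_star hA) -scalerAr.
rewrite scalerA; congr (_ *: _).
by rewrite expfzDr// -exprnN mulrC.
Qed.

(** * Convergence in norm *)

Section RealNorm.
Variables (R : realType) (V : normedZmodType R[i]).
Implicit Types x y : V.

(** The norm takes values in [R[i]]; its real part lets order and limit arguments be carried out in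
    [R]. *)
Definition rnorm x : R := complex.Re `|x|.

Lemma rnormE x : `|x| = (rnorm x)%:C.
Proof. by rewrite /rnorm RRe_real ?normr_real. Qed.

Lemma rnorm_ge0 x : 0 <= rnorm x.
Proof. by rewrite -ler0c -rnormE. Qed.

Lemma rnorm0 : rnorm 0 = 0.
Proof. by rewrite /rnorm normr0. Qed.

Lemma rnorm_eq0 x : rnorm x = 0 -> x = 0.
Proof. by move=> x0; apply: normr0_eq0; rewrite rnormE x0. Qed.

Lemma rnorm_le0 x : rnorm x <= 0 -> x = 0.
Proof. by move=> x0; apply: rnorm_eq0; apply/eqP; rewrite eq_le x0 rnorm_ge0. Qed.

Lemma rnormD x y : rnorm (x + y) <= rnorm x + rnorm y.
Proof. by rewrite -lecR rmorphD/= -!rnormE ler_normD. Qed.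

Lemma rnormN x : rnorm (- x) = rnorm x.
Proof. by rewrite /rnorm normrN. Qed.

Lemma rnormB x y : rnorm (x - y) <= rnorm x + rnorm y.
Proof. by rewrite -(rnormN y) rnormD. Qed.

Lemma rdistC x y : rnorm (x - y) = rnorm (y - x).
Proof. by rewrite /rnorm distrC. Qed.

Lemma rdistD z x y : rnorm (x - y) <= rnorm (x - z) + rnorm (z - y).
Proof. by apply: le_trans (rnormD _ _); rewrite addrA subrK. Qed.

End RealNorm.

Section ScalarNorm.
Variable R : realType.
Implicit Types c d : R[i].

Lemma rnormM c d : rnorm (c * d) = rnorm c * rnorm d.
Proof. by apply: complexI; rewrite rmorphM/= -!rnormE normrM. Qed.

Lemma rnormC (r : R) : rnorm (r%:C : R[i]) = `|r|.
Proof. by rewrite /rnorm normc_def/= expr0n addr0 sqrtr_sqr. Qed.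

Lemma rnorm_conj c : rnorm (Num.conj c) = rnorm c.
Proof. by rewrite /rnorm norm_conjC. Qed.

Lemma Re_le_rnorm c : `|complex.Re c| <= rnorm c.
Proof. by rewrite -lecR -rnormE normc_ge_Re. Qed.

Lemma rnormZ (V : normedModType R[i]) c (x : V) :
  rnorm (c *: x) = rnorm c * rnorm x.
Proof. by apply: complexI; rewrite rmorphM/= -!rnormE normrZ. Qed.

End ScalarNorm.

Section Tends.
Variable R : realType.

Lemma squeeze0 (u v : nat -> R) : (forall n, 0 <= u n <= v n) ->
  v @ \oo --> (0 : R) -> u @ \oo --> (0 : R).
Proof.
move=> uv v0; apply: (squeeze_cvgr _ (cvg_cst 0) v0).
by apply: nearW => n; exact: uv.
Qed.

Lemma cvg0M (u : nat -> R) c : u @ \oo --> (0 : R) ->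
  (fun n => c * u n) @ \oo --> (0 : R).
Proof. by move=> u0; rewrite -[X in _ --> X](mulr0 c); apply: cvgMr. Qed.

Lemma cvg0D (u v : nat -> R) : u @ \oo --> (0 : R) -> v @ \oo --> (0 : R) ->
  (fun n => u n + v n) @ \oo --> (0 : R).
Proof. by move=> u0 v0; rewrite -[X in _ --> X](addr0 0); apply: cvgD. Qed.

Section Space.
Variable V : normedZmodType R[i].
Implicit Types (x y : nat -> V) (l : V).

(** Convergence is measured by a real sequence, so that error bounds combine as real null
    sequences. *)
Definition tends x l := (fun n => rnorm (x n - l)) @ \oo --> (0 : R).

Lemma tends_le (e : nat -> R) x l : (forall n, rnorm (x n - l) <= e n) ->
  e @ \oo --> (0 : R) -> tends x l.
Proof. by move=> xe; apply: squeeze0 => n; rewrite rnorm_ge0 xe. Qed.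

Lemma tends_cst l : tends (fun=> l) l.
Proof. by rewrite /tends subrr rnorm0; exact: cvg_cst. Qed.

Lemma eq_tends x y l : x =1 y -> tends x l -> tends y l.
Proof. by move=> /funext ->. Qed.

Lemma tendsD x y l k : tends x l -> tends y k -> tends (fun n => x n + y n) (l + k).
Proof.
move=> xl yk; apply: tends_le (cvg0D xl yk) => n.
by rewrite opprD addrACA rnormD.
Qed.

Lemma tendsN x l : tends x l -> tends (fun n => - x n) (- l).
Proof. by apply: tends_le => n; rewrite -opprD rnormN. Qed.

Lemma tendsB x y l k : tends x l -> tends y k -> tends (fun n => x n - y n) (l - k).
Proof. by move=> xl /tendsN yk; exact: tendsD. Qed.

Lemma tends_unique x l k : tends x l -> tends x k -> l = k.
Proof.
move=> xl xk; apply/subr0_eq; apply: rnorm_le0.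
have : (fun n => rnorm (x n - l) + rnorm (x n - k)) @ \oo --> (0 : R).
  exact: cvg0D.
move=> /(@cvg_lim _ _)<-//; apply: limr_ge; first by apply: cvgP; exact: cvg0D.
by apply: nearW => n; rewrite (rdistC (x n) l) rdistD.
Qed.

Lemma tends_eps x l : tends x l <->
  forall e : R, 0 < e -> exists n0, forall n, (n0 <= n)%N -> rnorm (x n - l) < e.
Proof.
split=> [/cvgr0Pnorm_lt xl e e0|xl].
  have [n0 _ xn] := xl e e0; exists n0 => n n0n.
  by have := xn n n0n; rewrite /= ger0_norm ?rnorm_ge0.
apply/cvgr0Pnorm_lt => e e0; have [n0 xn] := xl e e0.
by exists n0 => // n /= n0n; rewrite ger0_norm ?rnorm_ge0 ?xn.
Qed.

Lemma tends_bounded x l : tends x l -> exists2 C : R, 0 <= C & forall n, rnorm (x n) <= C.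
Proof.
move=> /tends_eps/(_ 1 ltr01)[n0 xn].
pose C := \big[Order.max/(1 + rnorm l)]_(i < n0) rnorm (x i).
have CC n : rnorm (x n) <= C.
  have [n0n|nn0] := leqP n0 n; last first.
    by rewrite /C (bigD1 (Ordinal nn0))//= le_max lexx.
  apply: (@le_trans _ _ (1 + rnorm l)).
    rewrite -[x n](subrK l); apply: le_trans (rnormD _ _) _.
    by rewrite lerD2r ltW ?xn.
  exact: bigmax_ge_id.
by exists C => //; exact: le_trans (rnorm_ge0 _) (CC 0%N).
Qed.

End Space.

Lemma tends_map (V W : normedZmodType R[i]) (f : V -> W) (C : R) (x : nat -> V) l :
  (forall a b, rnorm (f a - f b) <= C * rnorm (a - b)) ->
  tends x l -> tends (fun n => f (x n)) (f l).
Proof. by move=> fC xl; apply: tends_le (cvg0M C xl). Qed.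

Lemma tendsZ (V : normedModType R[i]) c (x : nat -> V) l :
  tends x l -> tends (fun n => c *: x n) (c *: l).
Proof. by apply: (@tends_map _ _ _ (rnorm c)) => a b; rewrite -scalerBr rnormZ. Qed.

Lemma tendsM (x y : nat -> R[i]) l k :
  tends x l -> tends y k -> tends (fun n => x n * y n) (l * k).
Proof.
move=> xl yk; have [C C0 yC] := tends_bounded yk.
apply: tends_le (cvg0D (cvg0M C xl) (cvg0M (rnorm l) yk)) => n.
have -> : x n * y n - l * k = (x n - l) * y n + l * (y n - k) by ring.
apply: le_trans (rnormD _ _) _; rewrite !rnormM lerD// mulrC.
by rewrite ler_wpM2r ?rnorm_ge0.
Qed.

Section NormedModule.
Variable V : normedModType R[i].
Implicit Types (x y : nat -> V) (l : V).

Lemma tends_cvg x l : tends x l -> x @ \oo --> l.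
Proof.
move=> /tends_eps xl; apply/cvgrPdist_lt => e e0.
have [|n0 xn] := xl (complex.Re e); first by move: e0; rewrite ltcE => /andP[].
exists n0 => // n /xn; rewrite rdistC -ltcR -rnormE RRe_real//.
exact: gtr0_real.
Qed.

Lemma cvg_tends x l : x @ \oo --> l -> tends x l.
Proof.
move=> /cvgrPdist_lt xl; apply/tends_eps => e e0.
have [|n0 _ xn] := xl e%:C; first by rewrite ltcR.
by exists n0 => n /xn /=; rewrite rdistC rnormE ltcR.
Qed.

Lemma closed_tends (S : set V) x l : closed S -> (forall n, S (x n)) ->
  tends x l -> S l.
Proof.
move=> cS Sx /tends_cvg xl; apply: (@closed_cvg _ _ \oo _ x S cS _ l xl).
exact: nearW.
Qed.

End NormedModule.

Lemma cauchy_tends (V : completeNormedModType R[i]) (x : nat -> V) (e : nat -> R) :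
  (forall n m, (n <= m)%N -> rnorm (x n - x m) <= e n) ->
  e @ \oo --> (0 : R) -> exists l, tends x l.
Proof.
move=> xe /cvgr0Pnorm_lt e0; suff : cvg (x @ \oo) by move=> /cvg_tends; exists (lim (x @ \oo)).
apply: cauchy_cvg; apply/cauchyP => d d0.
have Rd : 0 < complex.Re d by move: d0; rewrite ltcE => /andP[].
have [n0 _ en] := e0 _ Rd; exists (x n0); exists n0 => // n /= n0n.
rewrite -ball_normE /ball_/= rnormE -[d]RRe_real ?gtr0_real// ltcR.
apply: le_lt_trans (xe _ _ n0n) _; apply: le_lt_trans (ler_norm _) _.
exact: en n0 (leqnn _).
Qed.

Lemma geometric_tends (V : completeNormedModType R[i]) (x : nat -> V) (C r : R) :
  0 <= r < 1 -> (forall n, rnorm (x n.+1 - x n) <= C * r ^+ n) ->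
  exists l, tends x l.
Proof.
move=> /andP[r0 r1] xC.
have C0 : 0 <= C by have := xC 0%N; rewrite expr0 mulr1; apply: le_trans (rnorm_ge0 _).
apply: (@cauchy_tends _ _ (fun n => C / (1 - r) * r ^+ n)); last first.
  by apply: cvg0M; apply: cvg_expr; rewrite ger0_norm.
move=> n m /subnK <-; rewrite addnC; move: (m - n)%N => k.
(* Keeping the subtracted power makes the telescoping induction an exact identity. *)
suff : rnorm (x n - x (n + k)%N) <= C / (1 - r) * (r ^+ n - r ^+ (n + k)).
  move=> /le_trans; apply; rewrite ler_wpM2l ?divr_ge0 ?subr_ge0 ?(ltW r1)//.
  by rewrite lerBlDr lerDl exprn_ge0.
elim: k => [|k IH]; first by rewrite addn0 !subrr rnorm0 mulr0.
rewrite addnS; apply: le_trans (rdistD (x (n + k)%N) _ _) _.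
rewrite (rdistC _ (x (n + k).+1)); apply: le_trans (lerD IH (xC _)) _.
rewrite exprS le_eqVlt; apply/orP; left; apply/eqP; field.
by rewrite subr_eq0 gt_eqF.
Qed.

End Tends.

(** * Hilbert spaces *)

Section HilbertGeometry.
Variables (R : realType) (H : hilbert R).
Implicit Types (x y z : H) (S : closedSubspace H).

Lemma ipDr x y z : ip x (y + z) = ip x y + ip x z.
Proof. by rewrite -[y]scale1r ip_lin mul1r !scale1r. Qed.

Lemma ipZr x c y : ip x (c *: y) = c * ip x y.
Proof. by rewrite -[c *: y]addr0 ip_lin ip0 addr0. Qed.

Lemma ipNr x y : ip x (- y) = - ip x y.
Proof. by rewrite -scaleN1r ipZr mulN1r. Qed.

Lemma ipBr x y z : ip x (y - z) = ip x y - ip x z.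
Proof. by rewrite ipDr ipNr. Qed.

Lemma ipDl x y z : ip (x + y) z = ip x z + ip y z.
Proof. by rewrite ip_conj ipDr rmorphD/= -!ip_conj. Qed.

Lemma ipZl c x y : ip (c *: x) y = Num.conj c * ip x y.
Proof. by rewrite ip_conj ipZr rmorphM/= -ip_conj. Qed.

Lemma ipNl x y : ip (- x) y = - ip x y.
Proof. by rewrite ip_conj ipNr rmorphN/= -ip_conj. Qed.

Lemma ipBl x y z : ip (x - y) z = ip x z - ip y z.
Proof. by rewrite ipDl ipNl. Qed.

Lemma ip_rnorm x : ip x x = (rnorm x ^+ 2)%:C.
Proof. by rewrite ip_norm rnormE rmorphXn. Qed.

Lemma rnorm_ip x y : rnorm (ip x y) <= rnorm x * rnorm y.
Proof. by rewrite -lecR rmorphM/= -!rnormE cauchy_schwarz. Qed.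

Lemma ReipC x y : complex.Re (ip x y) = complex.Re (ip y x).
Proof. by rewrite ip_conj; case: (ip y x). Qed.

Lemma rnormB_sqr x y :
  rnorm (x - y) ^+ 2 = rnorm x ^+ 2 - 2 * complex.Re (ip x y) + rnorm y ^+ 2.
Proof.
have E z : rnorm z ^+ 2 = complex.Re (ip z z) by rewrite ip_rnorm.
rewrite !E ipBl !ipBr !raddfB/= (ReipC y x); ring.
Qed.

Lemma rnormD_sqr x y :
  rnorm (x + y) ^+ 2 = rnorm x ^+ 2 + 2 * complex.Re (ip x y) + rnorm y ^+ 2.
Proof. by rewrite -[y in LHS]opprK rnormB_sqr ipNr rnormN raddfN/= mulrN opprK. Qed.

Lemma tends_ip (x y : nat -> H) a b :
  tends x a -> tends y b -> tends (fun n => ip (x n) (y n)) (ip a b).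
Proof.
move=> xa yb; have [C C0 yC] := tends_bounded yb.
apply: tends_le (cvg0D (cvg0M C xa) (cvg0M (rnorm a) yb)) => n.
have -> : ip (x n) (y n) - ip a b = ip (x n - a) (y n) + ip a (y n - b).
  by rewrite ipBl ipBr addrA subrK.
apply: le_trans (rnormD _ _) _; rewrite lerD//.
  by apply: le_trans (rnorm_ip _ _) _; rewrite mulrC ler_wpM2r ?rnorm_ge0.
exact: rnorm_ip.
Qed.

Lemma harmonic0 : (fun n => n.+1%:R^-1) @ \oo --> (0 : R).
Proof. exact: cvg_harmonic. Qed.

Lemma sqrt_harmonic0 : (fun n => Num.sqrt n.+1%:R^-1) @ \oo --> (0 : R).
Proof.
rewrite -[X in _ --> X](sqrtr0 R); apply: (cvg_comp _ _ harmonic0).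
exact: sqrt_continuous.
Qed.

Lemma le_cvg0 (a b : R) (e : nat -> R) :
  (forall n, a <= b + e n) -> e @ \oo --> (0 : R) -> a <= b.
Proof.
move=> abe e0; have : (fun n => b + e n) @ \oo --> b + 0.
  by apply: cvgD => //; exact: cvg_cst.
rewrite addr0 => be; rewrite -(cvg_lim _ be)//.
by apply: limr_ge; [exact: cvgP be | exact: nearW].
Qed.

(** A minimising sequence is Cauchy by the parallelogram law, and its limit attains the infimum. *)
Lemma closest_point S x : exists2 p, (S : set H) p &
  forall s, (S : set H) s -> rnorm (x - p) <= rnorm (x - s).
Proof.
have [S0 SD] := csub_lin S.
pose E : set R := [set rnorm (x - s) ^+ 2 | s in S].
have infE : has_inf E.
  split; first by exists (rnorm (x - 0) ^+ 2), 0.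
  by exists 0 => _ [s _ <-]; rewrite exprn_ge0 ?rnorm_ge0.
pose d := inf E.
have dE s : (S : set H) s -> d <= rnorm (x - s) ^+ 2.
  by move=> Ss; apply: ge_inf; [exact: infE.2 | exists s].
have /choice[p pP] n : exists s, (S : set H) s /\ rnorm (x - s) ^+ 2 < d + n.+1%:R^-1.
  have n0 : 0 < n.+1%:R^-1 :> R by rewrite invr_gt0.
  by have [_ [s Ss <-] sd] := inf_adherent n0 infE; exists s.
have Sp n : (S : set H) (p n) by have [] := pP n.
have mid n m : d <= rnorm (x - (2^-1 : R)%:C *: (p n + p m)) ^+ 2.
  apply: dE; rewrite -[_ *: _]addr0; apply: (SD) => //.
  by rewrite -[p n]scale1r; exact: SD.
(* The squared distances of [p n] and [p m] to [x] are at most d + 1/(n+1) and that of their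
   midpoint is at least d, so the squared distance of [p n] and [p m] is at most 4/(n+1). *)
have pC n m : (n <= m)%N -> rnorm (p n - p m) <= 2 * Num.sqrt n.+1%:R^-1.
  move=> nm; have mn : m.+1%:R^-1 <= n.+1%:R^-1 :> R.
    by rewrite lef_pV2 ?posrE// ler_nat ltnS.
  have half : x - (2^-1 : R)%:C *: (p n + p m) = (2^-1 : R)%:C *: ((x - p n) + (x - p m)).
    rewrite -[X in X - _](scale1r x) (_ : 1 = (2^-1 : R)%:C * 2%:R).
      rewrite -scalerA -scalerBr; congr (_ *: _).
      by rewrite scaler_nat mulr2n addrACA opprD.
    by apply/eqP; rewrite eq_complex/=; apply/andP; split; apply/eqP; field.
  have := mid n m; rewrite half rnormZ rnormC exprMn rnormD_sqr.
  have := rnormB_sqr (x - p n) (x - p m).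
  have -> : x - p n - (x - p m) = - (p n - p m).
    by rewrite !opprB addrC addrA subrK.
  rewrite rnormN => e1 e2.
  have [_ h1] := pP n; have [_ h2] := pP m.
  rewrite -[leLHS]ger0_norm ?rnorm_ge0// -sqrtr_sqr.
  have -> : 2 * Num.sqrt n.+1%:R^-1 = Num.sqrt (4 * n.+1%:R^-1) :> R.
    by rewrite sqrtrM// (_ : 4 = 2 ^+ 2) ?sqrtr_sqr ?ger0_norm// -natrX.
  rewrite ler_wsqrtr//.
  move: e2; rewrite ger0_norm ?invr_ge0// => e2.
  have e3 : 4 * d <= rnorm (x - p n) ^+ 2 +
      2 * complex.Re (ip (x - p n) (x - p m)) + rnorm (x - p m) ^+ 2.
    by rewrite mulrC -ler_pdivlMr// mulrC; move: e2; rewrite exprVn -natrX.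
  move: (n.+1%:R^-1) (m.+1%:R^-1) mn h1 h2 => a b; move: e1 e3.
  by move: (_ ^+ 2) (_ ^+ 2) (_ ^+ 2) (complex.Re _); move=> *; lra.
have [|l pl] := cauchy_tends pC; first exact: cvg0M sqrt_harmonic0.
exists l; first exact: closed_tends (@csub_closed _ _ S) Sp pl.
move=> s Ss; apply: (@le_trans _ _ (Num.sqrt d)); last first.
  rewrite -[leRHS]ger0_norm ?rnorm_ge0// -sqrtr_sqr ler_wsqrtr//; exact: dE.
have d0 : 0 <= d.
  by apply: lb_le_inf; [exact: infE.1 | move=> _ [t _ <-]; rewrite exprn_ge0 ?rnorm_ge0].
apply: le_cvg0 (cvg0D sqrt_harmonic0 pl) => n /=.
apply: le_trans (rdistD (p n) _ _) _; rewrite addrA lerD2r.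
have h0 : 0 <= n.+1%:R^-1 :> R by rewrite invr_ge0.
rewrite -(ler_pXn2r (ltn0Sn 1)) ?nnegrE ?rnorm_ge0 ?addr_ge0 ?sqrtr_ge0//.
have [_ /ltW/le_trans] := pP n; apply.
rewrite sqrrD !sqr_sqrtr// addrAC lerDl mulrn_wge0// mulr_ge0// sqrtr_ge0.
Qed.

Lemma projection S x : exists2 p, (S : set H) p & ortho_set S (x - p).
Proof.
have [p Sp pmin] := closest_point S x; exists p => // s Ss.
apply/eqP/negPn/negP => sz0; set z := x - p in sz0.
pose w := ip z s; have w0 : 0 < rnorm w.
  rewrite lt_neqAle rnorm_ge0 andbT eq_sym; apply: contra_neq sz0 => /rnorm_eq0.
  by rewrite -/z ip_conj -/w => ->; rewrite conjC0.
(* Moving [p] by [t] changes the squared distance by - 2 e |w|^2 + e^2 |w|^2 |s|^2. This [e]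
   satisfies e |s|^2 = 1 - e, which makes the change negative. *)
pose e : R := (1 + rnorm s ^+ 2)^-1.
have s1 : 0 < 1 + rnorm s ^+ 2 by rewrite ltr_pwDl// exprn_ge0 ?rnorm_ge0.
pose t := (e%:C * Num.conj w) *: s.
have St : (S : set H) (p + t) by rewrite addrC; apply: (csub_lin S).2.
have := pmin _ St; rewrite opprD addrA -/z.
rewrite -(ler_pXn2r (ltn0Sn 1)) ?nnegrE ?rnorm_ge0// -/z (rnormB_sqr z t).
have -> : ip z t = (e * rnorm w ^+ 2)%:C.
  by rewrite ipZr -/w -mulrA (mulrC (Num.conj w)) -normCK rnormE rmorphM rmorphXn.
have e0 : 0 < e by rewrite invr_gt0.
have -> : rnorm t = e * rnorm w * rnorm s.
  by rewrite rnormZ rnormM rnorm_conj rnormC ger0_norm ?ltW.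
rewrite !exprMn /=.
have W0 : 0 < rnorm w ^+ 2 by rewrite exprn_gt0.
have eS : e * rnorm s ^+ 2 = 1 - e.
  by have := mulVf (lt0r_neq0 s1); rewrite -/e mulrDr mulr1; move: (e * _) => b; lra.
have -> : e ^+ 2 * rnorm w ^+ 2 * rnorm s ^+ 2 =
    e * rnorm w ^+ 2 * (e * rnorm s ^+ 2) by ring.
rewrite eS.
have := mulr_gt0 e0 W0.
have := mulr_gt0 e0 (mulr_gt0 e0 W0).
move: (rnorm w ^+ 2) (rnorm z ^+ 2) => a b; nra.
Qed.

End HilbertGeometry.

(** Null vectors are allowed, as in the form that a generating functional induces on the algebra.
    Like [ip], the form is linear in its second argument. *)
Record semi_dot (R : realType) (V : lmodType R[i]) := SemiDot {
  sdot :> V -> V -> R[i];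
  sdot_lin : forall x c y z, sdot x (c *: y + z) = c * sdot x y + sdot x z;
  sdot_conj : forall x y, sdot x y = Num.conj (sdot y x);
  sdot_ge0 : forall x, 0 <= sdot x x
}.

Section SemiDotTheory.
Variables (R : realType) (V : lmodType R[i]) (B : semi_dot V).
Implicit Types x y z : V.

Lemma sdotDr x y z : B x (y + z) = B x y + B x z.
Proof. by rewrite -[y]scale1r sdot_lin mul1r !scale1r. Qed.

Lemma sdot0r x : B x 0 = 0.
Proof. by apply: (addrI (B x 0)); rewrite -sdotDr !addr0. Qed.

Lemma sdotZr x c y : B x (c *: y) = c * B x y.
Proof. by rewrite -[c *: y]addr0 sdot_lin sdot0r addr0. Qed.

Lemma sdotBr x y z : B x (y - z) = B x y - B x z.
Proof. by rewrite -scaleN1r sdotDr sdotZr mulN1r. Qed.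

Lemma sdotDl x y z : B (x + y) z = B x z + B y z.
Proof. by rewrite sdot_conj sdotDr rmorphD/= -!sdot_conj. Qed.

Lemma sdotZl c x y : B (c *: x) y = Num.conj c * B x y.
Proof. by rewrite sdot_conj sdotZr rmorphM/= -sdot_conj. Qed.

Lemma sdotBl x y z : B (x - y) z = B x z - B y z.
Proof. by rewrite sdot_conj sdotBr rmorphB/= -!sdot_conj. Qed.

Definition snorm x : R := Num.sqrt (complex.Re (B x x)).

Lemma snorm_ge0 x : 0 <= snorm x. Proof. exact: sqrtr_ge0. Qed.

Lemma snorm_sqr x : (snorm x ^+ 2)%:C = B x x.
Proof.
rewrite sqr_sqrtr ?RRe_real ?ger0_real ?sdot_ge0//.
by have := sdot_ge0 B x; rewrite lecE => /andP[].
Qed.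

Lemma sdot_cauchy x y : rnorm (B x y) <= snorm x * snorm y.
Proof.
rewrite -(ler_pXn2r (ltn0Sn 1)) ?nnegrE ?mulr_ge0 ?snorm_ge0 ?rnorm_ge0//.
set w := B x y; rewrite exprMn.
have key (t : R) : 0 <= snorm x ^+ 2 - 2 * t * rnorm w ^+ 2
    + t ^+ 2 * rnorm w ^+ 2 * snorm y ^+ 2.
  have := sdot_ge0 B (x - (t%:C * Num.conj w) *: y).
  have ww : w * Num.conj w = (rnorm w ^+ 2)%:C by rewrite -normCK rnormE rmorphXn.
  have tt : Num.conj t%:C = t%:C :> R[i] by rewrite conj_Creal ?complex_real.
  rewrite sdotBl !sdotBr !sdotZl !sdotZr (sdot_conj B y x) -/w.
  rewrite rmorphM/= tt conjCK.
  have -> : B x x - t%:C * Num.conj w * w -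
      (t%:C * w * Num.conj w - t%:C * w * (t%:C * Num.conj w * B y y)) =
      B x x - 2 * t%:C * (w * Num.conj w) + t%:C * t%:C * (w * Num.conj w) * B y y.
    ring.
  by rewrite ww -!snorm_sqr -[2](rmorph_nat (@real_complex R)) -!rmorphM -rmorphB
    -rmorphD ler0c expr2.
have x0 : 0 <= snorm x ^+ 2 by rewrite exprn_ge0 ?snorm_ge0.
have y0 : 0 <= snorm y ^+ 2 by rewrite exprn_ge0 ?snorm_ge0.
have w0 : 0 <= rnorm w ^+ 2 by rewrite exprn_ge0 ?rnorm_ge0.
move: key x0 y0 w0; move: (snorm x ^+ 2) (snorm y ^+ 2) (rnorm w ^+ 2) => X Y W.
(* If Y = 0 and W is nonzero, the chosen t turns the polynomial in [key] into -1; otherwise its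
   minimum, at t = 1/Y, gives the inequality. *)
move=> key X0 Y0 W0; have [Y00|Yn0] := eqVneq Y 0.
  rewrite Y00 mulr0; have := key ((X + 1) / 2 / W).
  have [->//|Wn0] := eqVneq W 0.
  rewrite Y00 mulr0 addr0 (_ : 2 * ((X + 1) / 2 / W) * W = X + 1); last by field.
  by move=> h; exfalso; move: h; lra.
have := key Y^-1; rewrite (_ : Y^-1 ^+ 2 * W * Y = W / Y); last by field.
rewrite (_ : 2 * Y^-1 * W = 2 * (W / Y)); last by field.
rewrite -ler_pdivrMr ?lt_def ?Yn0 ?Y0//.
by move: (W / Y) => Z h; lra.
Qed.

Lemma snormD x y : snorm (x + y) <= snorm x + snorm y.
Proof.
rewrite -(ler_pXn2r (ltn0Sn 1)) ?nnegrE ?addr_ge0 ?snorm_ge0//.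
have E z : snorm z ^+ 2 = complex.Re (B z z) by rewrite -snorm_sqr.
rewrite sqrrD !E sdotDl !sdotDr !raddfD/= (sdot_conj B y x).
have := sdot_cauchy x y; have := Re_le_rnorm (B x y).
have -> : complex.Re (Num.conj (B x y)) = complex.Re (B x y) by case: (B x y).
rewrite ler_norml => /andP[_ h1] h2.
have := le_trans h1 h2; move: (_ * snorm y) (complex.Re _) => a b.
by rewrite mulr2n; lra.
Qed.

Lemma snormZ c x : snorm (c *: x) = rnorm c * snorm x.
Proof.
rewrite /snorm sdotZl sdotZr mulrA (mulrC (Num.conj c)) -normCK rnormE.
rewrite -rmorphXn -snorm_sqr -rmorphM/= sqrtrM ?exprn_ge0 ?rnorm_ge0//.
by rewrite !sqrtr_sqr !ger0_norm ?snorm_ge0 ?rnorm_ge0.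
Qed.

Lemma snormBC x y : snorm (x - y) = snorm (y - x).
Proof.
have -> : x - y = -1 *: (y - x) by rewrite scaleN1r opprB.
by rewrite snormZ /rnorm normrN1 /= mul1r.
Qed.

(** One has |T x|^2 = <x, S T x> <= C |x| |T x|. *)
Lemma sdot_adjoint_le (S T : V -> V) (C : R) :
  (forall x y, B (T x) y = B x (S y)) -> (forall x, snorm (S x) <= C * snorm x) ->
  forall x, snorm (T x) <= C * snorm x.
Proof.
move=> adj SC x; have [->|Tx0] := eqVneq (snorm (T x)) 0.
  exact: le_trans (snorm_ge0 _) (SC x).
have Tx : 0 < snorm (T x) by rewrite lt_def Tx0 snorm_ge0.
rewrite -(ler_pM2r Tx) -expr2 -mulrA (mulrC (snorm x)) mulrA.
rewrite -[leLHS]ger0_norm ?exprn_ge0 ?snorm_ge0// -rnormC snorm_sqr adj.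
apply: le_trans (sdot_cauchy _ _) _; by rewrite mulrC ler_wpM2r ?snorm_ge0.
Qed.

End SemiDotTheory.

(* [T 1] is only required to be the identity up to null vectors of [B]: in the
   GNS construction it subtracts the counit. *)
Lemma suq_contraction (R : realType) (q : R) N (A : starAlg R) (u : 'M[A]_N)
    (V : lmodType R[i]) (B : semi_dot V) (T : A -> V -> V) :
  0 < q < 1 -> is_SUq q u ->
  (forall x, B x (T 1 x) = B x x) -> (forall a b x, T (a * b) x = T a (T b x)) ->
  (forall a b x, T (a + b) x = T a x + T b x) ->
  (forall a x y, B (T (star a) x) y = B x (T a y)) ->
  forall j k x, snorm B (T (u j k) x) <= snorm B x.
Proof.
move=> q01 hA T1 TM TD Tstar j k x.
have T0 y : T 0 y = 0 by apply: (addrI (T 0 y)); rewrite -TD !addr0.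
(* The bound is proved for the adjoint: unitarity says that |x|^2 is the sum over s of |T (star (u j
   s)) x|^2, which dominates each summand. *)
rewrite -[leRHS]mul1r; apply: (@sdot_adjoint_le _ _ _ (T (star (u j k)))).
  by move=> y z; rewrite -Tstar starK.
move=> {}x; rewrite mul1r.
rewrite -(ler_pXn2r (ltn0Sn 1)) ?nnegrE ?snorm_ge0// -lecR !snorm_sqr.
have Tsum (s : seq 'I_N) : T (\sum_(i <- s) u j i * star (u j i)) x =
    \sum_(i <- s) T (u j i) (T (star (u j i)) x).
  by elim: s => [|i s IH]; rewrite ?big_nil// !big_cons TD TM IH.
have Bsum (s : seq 'I_N) : B x (\sum_(i <- s) T (u j i) (T (star (u j i)) x)) =
    \sum_(i <- s) B (T (star (u j i)) x) (T (star (u j i)) x).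
  elim: s => [|i s IH]; rewrite ?big_nil ?sdot0r// !big_cons sdotDr IH.
  by rewrite Tstar.
rewrite -(T1 x) -(suq_unitary j q01 hA) Tsum Bsum (bigD1 k)//=.
by rewrite lerDl sumr_ge0// => i _; exact: sdot_ge0.
Qed.

(** * Resolvents of contractions *)

Section Contraction.
Variables (R : realType) (H : hilbert R) (T : {linear H -> H}).
Hypothesis T_le : forall x, rnorm (T x) <= rnorm x.
Implicit Types (x y w : H) (r : R).

(** This says w = (1 - r T)^-1 x, as a relation, so that identities between resolvents are checked
    by multiplying out. *)
Definition resolvent_eq r w x := w - r%:C *: T w = x.

Lemma resolvent_le r w x : 0 <= r < 1 -> resolvent_eq r w x ->
  (1 - r) * rnorm w <= rnorm x.
Proof.
move=> /andP[r0 r1] <-; rewrite mulrBl mul1r lerBlDr.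
rewrite -[X in rnorm X <= _](subrK (r%:C *: T w)).
apply: le_trans (rnormD _ _) _; rewrite lerD2l rnormZ rnormC ger0_norm//.
by rewrite ler_wpM2l.
Qed.

Lemma resolvent_comb r c w x w' x' : resolvent_eq r w x ->
  resolvent_eq r w' x' -> resolvent_eq r (c *: w + w') (c *: x + x').
Proof.
move=> <- <-; rewrite /resolvent_eq linearP scalerDr scalerBr !scalerA (mulrC c).
by rewrite opprD addrACA.
Qed.

(** Banach iteration of the r-contraction w |-> x + r T w. *)
Lemma resolvent_ex r x : 0 <= r < 1 -> exists w, resolvent_eq r w x.
Proof.
move=> /andP[r0 r1]; pose f w := x + r%:C *: T w; pose s n := iter n f 0.
have fB a b : rnorm (f a - f b) <= r * rnorm (a - b).
  rewrite /f opprD addrACA subrr add0r -scalerBr -linearB rnormZ rnormC.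
  by rewrite ger0_norm// ler_wpM2l.
have [|n|l sl] := @geometric_tends _ _ s (rnorm x) r; first by rewrite r0.
  elim: n => [|n IH].
    by rewrite /= /f linear0 scaler0 addr0 subr0 expr0 mulr1.
  rewrite exprS mulrCA; apply: le_trans (fB _ _) _; exact: ler_wpM2l.
exists l; apply/eqP; rewrite /resolvent_eq subr_eq; apply/eqP.
have s1 : tends (fun n => s n.+1) l.
  apply/tends_eps => e e0; have /tends_eps/(_ e e0)[n0 sn] := sl.
  by exists n0 => n n0n; apply: sn; exact: leqW.
exact: tends_unique s1 (tends_map fB sl).
Qed.

Variables (T' : H -> H).
Hypothesis T_adj : forall x y, ip (T' x) y = ip x (T y).
Hypothesis T_inj : forall x, T x = x -> x = 0.

(** Mean ergodic theorem in Abel form: (1 - r) (1 - r T)^-1 tends strongly to the projection onto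
    the fixed vectors of [T], here 0. These operators are contractions, so their argument may run
    along a convergent sequence. *)
Lemma ergodic (r : nat -> R) (x w : nat -> H) (l : H) :
  (forall n, 0 <= r n < 1) -> (fun n => 1 - r n) @ \oo --> (0 : R) ->
  tends x l -> (forall n, resolvent_eq (r n) (w n) ((1 - r n)%:C *: x n)) ->
  tends w 0.
Proof.
move=> r01 r1 xl wx.
have r1_gt0 n : 0 < 1 - r n by rewrite subr_gt0; case/andP: (r01 n).
have /choice[J' J'P] n : exists J, forall y, resolvent_eq (r n) (J y) ((1 - r n)%:C *: y).
  have /choice[J JP] y := resolvent_ex ((1 - r n)%:C *: y) (r01 n).
  by exists J.
have res_le n a y : resolvent_eq (r n) a ((1 - r n)%:C *: y) -> rnorm a <= rnorm y.
  move=> /resolvent_le -/(_ (r01 n)); rewrite rnormZ rnormC gtr0_norm//.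
  by rewrite ler_pM2l.
have res_dist n a y a' y' : resolvent_eq (r n) a ((1 - r n)%:C *: y) ->
    resolvent_eq (r n) a' ((1 - r n)%:C *: y') -> rnorm (a - a') <= rnorm (y - y').
  move=> ay ay'; have := resolvent_comb (-1) ay' ay.
  rewrite !scaleN1r -scalerN -scalerDr => /res_le.
  by rewrite addrC [- y' + y]addrC.
(* [S] is a closed subspace which contains the range of [1 - T], and a vector
   orthogonal to that range is fixed by [T]. *)
pose S : set H := [set y | tends (fun n => J' n y) 0].
have J0 y : S y <-> (fun n => rnorm (J' n y)) @ \oo --> (0 : R).
  by rewrite /S/= /tends; under eq_fun do rewrite subr0.
have SE (y : H) (e : nat -> R) : (forall n, rnorm (J' n y) <= e n) ->
    e @ \oo --> (0 : R) -> S y.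
  by move=> ye e0; apply: tends_le e0 => n; rewrite subr0.
have S0 : S 0.
  by apply: (SE _ (fun=> 0)) (cvg_cst _) => n; have := res_le _ _ _ (J'P n 0); rewrite rnorm0.
have SD c a b : S a -> S b -> S (c *: a + b).
  move=> /J0 Sa /J0 Sb; apply: SE (cvg0D (cvg0M (rnorm c) Sa) Sb) => n /=.
  apply: le_trans (_ : rnorm (c *: J' n a + J' n b) <= _).
    have : rnorm (J' n (c *: a + b) - (c *: J' n a + J' n b)) <= 0.
      rewrite -(@rnorm0 _ H) -(subrr (c *: a + b)); apply: res_dist (J'P _ _) _.
      rewrite scalerDr scalerA (mulrC _ c) -scalerA.
      by apply: resolvent_comb; exact: J'P.
    by move=> /rnorm_le0/subr0_eq ->.
  by apply: le_trans (rnormD _ _) _; rewrite rnormZ.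
have clS : closed S.
  move=> y cly; apply/J0/cvgr0Pnorm_lt => e e0.
  have e2 : 0 < e / 2 by rewrite divr_gt0.
  have [|z [/J0/cvgr0Pnorm_lt Sz yz]] := cly _ (@nbhsx_ballx _ _ y (e / 2)%:C _).
    by rewrite ltcR.
  have [n0 _ zn] := Sz _ e2; exists n0 => // n /zn /=.
  rewrite !ger0_norm ?rnorm_ge0// => Jz.
  have yz' : rnorm (y - z) < e / 2.
    by move: yz; rewrite -ball_normE /ball_/= rnormE ltcR.
  rewrite -[J' n y](subrK (J' n z)); apply: le_lt_trans (rnormD _ _) _.
  rewrite [e]splitr ltrD//; apply: le_lt_trans yz'; exact: res_dist (J'P _ _) (J'P _ _).
(* Since 1 - T = (1 - r T) - (1 - r) T, the operator [J' n] maps y - T y to (1 - r) (y - J' n (T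
   y)). *)
have ST y : S (y - T y).
  apply: (SE _ (fun n => 2 * rnorm y * (1 - r n))); last exact: cvg0M.
  move=> n; have -> : J' n (y - T y) = (1 - r n)%:C *: (y - J' n (T y)).
    apply/subr0_eq/rnorm_le0; rewrite -(@rnorm0 _ H) -(subrr (y - T y)).
    apply: res_dist (J'P _ _) _.
    have yE : resolvent_eq (r n) y (y - (r n)%:C *: T y) by [].
    have zE : resolvent_eq (r n) 0 0 by rewrite /resolvent_eq linear0 scaler0 subr0.
    have := resolvent_comb (1 - r n)%:C (resolvent_comb (-1) (J'P n (T y)) yE) zE.
    rewrite !addr0 !scaleN1r (addrC (- J' _ _)); congr (resolvent_eq _ _ (_ *: _)).
    by rewrite addrCA -opprD -scalerDl -rmorphD/= subrK scale1r.
  rewrite rnormZ rnormC gtr0_norm// mulrC ler_pM2r//.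
  apply: le_trans (rnormB _ _) _; rewrite mulr_natl mulr2n lerD2l.
  exact: le_trans (res_le _ _ _ (J'P _ _)) (T_le _).
pose CS := ClosedSubspace (conj S0 SD) clS.
have Sall y : S y.
  have [p Sp zS] := projection CS y; suff : y - p = 0 by move=> /subr0_eq ->.
  set z := y - p in zS *; apply: T_inj.
  have T'z : T' z = z.
    have : ip (z - T' z) (z - T' z) = 0.
      by rewrite ipBl T_adj -ipBr ip_conj (zS _ (ST _)) conjC0.
    rewrite ip_rnorm => /(@complexI _ _ 0)/eqP; rewrite sqrf_eq0 => /eqP.
    by move=> /rnorm_eq0/subr0_eq.
  (* As <z, T z> = <T' z, z> = |z|^2 and [T] is a contraction, |T z - z|^2 <= 0. *)
  apply/subr0_eq/rnorm_eq0/eqP; rewrite -sqrf_eq0 eq_le exprn_ge0 ?rnorm_ge0// andbT.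
  rewrite rnormB_sqr ReipC -T_adj T'z ip_rnorm /=.
  have : rnorm (T z) ^+ 2 <= rnorm z ^+ 2 by rewrite ler_pXn2r ?nnegrE ?rnorm_ge0.
  by lra.
have := Sall l; move=> /J0 Jl; apply: tends_le (cvg0D xl Jl) => n; rewrite subr0.
rewrite -[w n](subrK (J' n l)); apply: le_trans (rnormD _ _) _; rewrite lerD2r.
exact: res_dist (wx n) (J'P _ _).
Qed.

End Contraction.

(** * Representations and cocycles *)

Section OrthogonalSplitting.
Variables (R : realType) (H : hilbert R) (S : closedSubspace H).
Implicit Types x y : H.

(** Testing against all [w] turns identities between vectors into scalar ones, which [ring] can
    close. *)
Lemma ip_ext x y : (forall w, ip w x = ip w y) -> x = y.
Proof.
move=> xy; apply/subr0_eq/rnorm_eq0/eqP; rewrite -sqrf_eq0 -(inj_eq (@complexI R)).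
by rewrite -ip_rnorm ipBr xy subrr.
Qed.

Lemma csub_ortho x : (S : set H) x -> ortho_set S x -> x = 0.
Proof.
move=> Sx /(_ x Sx); rewrite ip_rnorm => /(@complexI _ _ 0)/eqP.
by rewrite sqrf_eq0 => /eqP/rnorm_eq0.
Qed.

Lemma csub_setB x y : (S : set H) x -> (S : set H) y -> (S : set H) (x - y).
Proof. by move=> Sx Sy; rewrite addrC -scaleN1r; apply: (csub_lin S).2. Qed.

Lemma csub_val0 : csub_val (0 : subhilbert S) = 0.
Proof.
apply: (addrI (csub_val (0 : subhilbert S))).
by have := subhilbert_comb 1 (0 : subhilbert S) 0; rewrite !scale1r !addr0.
Qed.

Lemma csub_valZ c (x : subhilbert S) : csub_val (c *: x) = c *: csub_val x.
Proof. by rewrite -[c *: x]addr0 subhilbert_comb csub_val0 addr0. Qed.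

Lemma csub_valD (x y : subhilbert S) : csub_val (x + y) = csub_val x + csub_val y.
Proof. by rewrite -[x]scale1r subhilbert_comb !scale1r. Qed.

Lemma csub_valB (x y : subhilbert S) : csub_val (x - y) = csub_val x - csub_val y.
Proof. by rewrite csub_valD -scaleN1r csub_valZ scaleN1r. Qed.

Definition proj x : subhilbert S := csub_mk (s2valP (cid2 (projection S x))).

Definition coproj x : subhilbert (ortho S) :=
  @csub_mk _ _ (ortho S) _ (s2valP' (cid2 (projection S x))).

Lemma proj_coproj x : csub_val (proj x) + csub_val (coproj x) = x.
Proof. by rewrite /= addrC subrK. Qed.

(** The two differences of components are opposite, hence lie in [S] and in its complement.
    Linearity of the projections and the splitting of cocycles are instances of this uniqueness. *)
Lemma proj_unique (x : H) (p : subhilbert S) (z : subhilbert (ortho S)) :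
  x = csub_val p + csub_val z -> p = proj x /\ z = coproj x.
Proof.
move=> xE; have pE : csub_val p - csub_val (proj x) = csub_val (coproj x) - csub_val z.
  apply/eqP; rewrite subr_eq addrAC eq_sym subr_eq.
  by rewrite (addrC (csub_val (coproj x))) proj_coproj -xE.
have /subr0_eq pp : csub_val p - csub_val (proj x) = 0.
  apply: csub_ortho.
    by apply: csub_setB; [exact: (csub_valP p) | exact: (csub_valP (proj x))].
  rewrite pE addrC -scaleN1r.
  by apply: (ortho_lin S).2; [exact: (csub_valP z) | exact: (csub_valP (coproj x))].
move: pE; rewrite pp subrr => /esym/subr0_eq zz.
by split; apply: val_inj; rewrite /= ?pp ?zz.
Qed.

Lemma ip_ortho_sum (p p' : subhilbert S) (z z' : subhilbert (ortho S)) :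
  ip (csub_val p + csub_val z) (csub_val p' + csub_val z') = ip p p' + ip z z'.
Proof.
have orth (a : subhilbert S) (b : subhilbert (ortho S)) :
  ip (csub_val a) (csub_val b) = 0 by exact: (csub_valP b _ (csub_valP a)).
by rewrite ipDl !ipDr orth (ip_conj (csub_val z)) orth conjC0 addr0 add0r.
Qed.

Lemma proj_coproj_linear c x y :
  c *: proj x + proj y = proj (c *: x + y) /\
  c *: coproj x + coproj y = coproj (c *: x + y).
Proof.
apply: proj_unique; rewrite !subhilbert_comb -[in LHS](proj_coproj x).
by rewrite -[in LHS](proj_coproj y) scalerDr addrACA.
Qed.

Lemma proj_linear : linear proj.
Proof. by move=> c x y; rewrite (proj_coproj_linear c x y).1. Qed.

Lemma coproj_linear : linear coproj.
Proof. by move=> c x y; rewrite (proj_coproj_linear c x y).2. Qed.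

HB.instance Definition _ :=
  GRing.isLinear.Build R[i] H (subhilbert S) *:%R proj proj_linear.
HB.instance Definition _ :=
  GRing.isLinear.Build R[i] H (subhilbert (ortho S)) *:%R coproj coproj_linear.

End OrthogonalSplitting.

Section CocycleSplitting.
Variables (R : realType) (A : starAlg R) (H : hilbert R) (pi : starRep A H).
Variables (S : closedSubspace H) (invS : invariant_subspace pi S).

Lemma ortho_inv : invariant_subspace pi (ortho S).
Proof. by move=> a x Ox y Sy; rewrite -rep_star; apply: Ox; exact: invS. Qed.

Lemma cocycle_proj (invO : invariant_subspace pi (ortho S)) (eta : {linear A -> H}) :
  cocycle pi eta ->
  cocycle (restr invS) (proj S \o eta) /\ cocycle (restr invO) (coproj S \o eta).
Proof.
move=> eta_coc; suff E a b : restr invS a (proj S (eta b)) + counit A b *: proj S (eta a) =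
      proj S (eta (a * b)) /\
    restr invO a (coproj S (eta b)) + counit A b *: coproj S (eta a) =
      coproj S (eta (a * b)).
  by split=> a b; have [] := E a b.
apply: proj_unique; rewrite ![_ + counit A b *: _]addrC !subhilbert_comb.
rewrite eta_coc -[in LHS](proj_coproj S (eta a)) -[in LHS](proj_coproj S (eta b)).
by rewrite scalerDr linearD /= addrC addrACA.
Qed.

End CocycleSplitting.

Section Representation.
Variables (R : realType) (A : starAlg R) (H : hilbert R) (pi : starRep A H).

Lemma repD a b x : pi (a + b) x = pi a x + pi b x.
Proof. by rewrite -[a]scale1r repP !scale1r. Qed.

Lemma rep0 x : pi 0 x = 0.
Proof. by apply: (addrI (pi 0 x)); rewrite -repD !addr0. Qed.

Lemma repZ c a x : pi (c *: a) x = c *: pi a x.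
Proof. by rewrite -[c *: a]addr0 repP rep0 addr0. Qed.

Lemma repB a b x : pi (a - b) x = pi a x - pi b x.
Proof. by rewrite repD -scaleN1r repZ scaleN1r. Qed.

Lemma repDr a x y : pi a (x + y) = pi a x + pi a y.
Proof. exact: linearD. Qed.

Lemma repNr a x : pi a (- x) = - pi a x.
Proof. exact: linearN. Qed.

Lemma repZr a c x : pi a (c *: x) = c *: pi a x.
Proof. exact: linearZ. Qed.

Lemma tends_rep a (x : nat -> H) l : tends x l -> tends (fun n => pi a (x n)) (pi a l).
Proof.
move=> /tends_cvg xl; apply: cvg_tends; apply: (cvg_comp _ _ xl).
exact: rep_cont.
Qed.

Lemma cocycle1 (eta : {linear A -> H}) : cocycle pi eta -> eta 1 = 0.
Proof.
move=> eta_coc; apply: (addrI (eta 1)); rewrite addr0.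
by rewrite -[in RHS](mulr1 1) eta_coc rep1 rmorph1 scale1r.
Qed.

Definition approximable (eta : A -> H) := exists v : nat -> H, forall a,
  tends (fun n => pi a (v n) - counit A a *: v n) (eta a).

Variables (q : R) (N : nat) (u : 'M[A]_N).
Hypotheses (hq : 0 < q < 1) (hA : is_SUq q u).

Definition ip_semi : semi_dot H :=
  SemiDot (@ip_lin R H) (@ip_conj R H) (fun x => dnorm_ge0 _ _).

Lemma rep_u_le j k x : rnorm (pi (u j k) x) <= rnorm x.
Proof.
have E y : snorm ip_semi y = rnorm y.
  by rewrite /snorm [ip_semi y y]ip_rnorm /= sqrtr_sqr ger0_norm ?rnorm_ge0.
rewrite -!E; apply: (@suq_contraction R q N A u H ip_semi (fun a y => pi a y) hq hA).
- by move=> y; rewrite rep1.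
- exact: repM.
- exact: repD.
- exact: rep_star.
Qed.

Lemma gen_invariant (S : closedSubspace H) :
  (forall j k x, (S : set H) x -> (S : set H) (pi (u j k) x)) ->
  invariant_subspace pi S.
Proof.
move=> Su.
apply: (@suq_ind _ _ _ _ _ (fun a => forall x, (S : set H) x -> (S : set H) (pi a x)) hA).
- by move=> x Sx; rewrite rep1.
- by move=> c a b Sa Sb x Sx; rewrite repP; apply: (csub_lin S).2; [exact: Sa | exact: Sb].
- by move=> a b Sa Sb x Sx; rewrite repM; apply: Sa; exact: Sb.
- by move=> j k x; exact: Su.
Qed.

Lemma gen_fixed x : (forall j k, pi (u j k) x = (j == k)%:R *: x) ->
  forall a, pi a x = counit A a *: x.
Proof.
move=> xu; apply: (suq_ind hA).
- by rewrite rep1 rmorph1 scale1r.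
- by move=> c a b xa xb; rewrite repP xa xb linearP scalerDl scalerA.
- by move=> a b xa xb; rewrite repM xb linearZ/= xa scalerA mulrC -rmorphM.
- by move=> j k; rewrite xu (suq_counit hA).
Qed.

(** Coboundaries satisfy the cocycle identity too, and each [pi a] is continuous, so convergence
    passes from the generators to products and linear combinations. *)
Lemma gen_approximable (eta : {linear A -> H}) (v : nat -> H) : cocycle pi eta ->
  (forall j k, tends (fun n => pi (u j k) (v n) - (j == k)%:R *: v n) (eta (u j k))) ->
  approximable eta.
Proof.
move=> eta_coc vu; exists v; apply: (suq_ind hA).
- rewrite cocycle1//; apply: eq_tends _ (tends_cst _) => n.
  by rewrite rep1 rmorph1 scale1r subrr.
- move=> c a b va vb; rewrite [eta _]linearP.
  apply: eq_tends _ (tendsD (tendsZ c va) vb) => n.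
  by rewrite repP linearP scalerDl opprD scalerBr scalerA addrACA.
- move=> a b va vb; rewrite eta_coc.
  apply: eq_tends _ (tendsD (tends_rep a vb) (tendsZ (counit A b) va)) => n.
  rewrite repM linearB linearZ/= scalerBr addrA subrK scalerA mulrC.
  by rewrite rmorphM.
- by move=> j k; rewrite (suq_counit hA).
Qed.

End Representation.

(** * Approximation by coboundaries *)

Section ResolventLimit.
Variables (R : realType) (H : hilbert R) (T : {linear H -> H}).
Hypothesis T_le : forall x, rnorm (T x) <= rnorm x.

(** The difference g n - l solves the equation with right-hand side - (1 - r n) q T l. As the
    parameter stays below q < 1, its norm is O(1 - r n). *)
Lemma resolvent_tends (q : R) (r : nat -> R) (g : nat -> H) (l w : H) :
  0 < q < 1 -> (forall n, 0 <= r n < 1) -> (fun n => 1 - r n) @ \oo --> (0 : R) ->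
  resolvent_eq T q l w -> (forall n, resolvent_eq T (r n * q) (g n) w) ->
  tends g l.
Proof.
move=> /andP[q0 q1] r01 r1 lw gw.
have q1' : 0 < 1 - q by rewrite subr_gt0.
apply: (@tends_le _ _ (fun n => q / (1 - q) * rnorm l * (1 - r n))); last exact: cvg0M.
move=> n; have /andP[rn0 rn1] := r01 n.
have rq : r n * q <= q by rewrite ler_piMl ?ltW.
have gl : resolvent_eq T (r n * q) (g n - l) (- ((1 - r n) * q)%:C *: T l).
  rewrite /resolvent_eq; have := gw n; rewrite /resolvent_eq -lw => gE.
  apply: ip_ext => z; have /(congr1 (ip z)) := gE.
  rewrite linearB !(ipBr, ipZr) !(rmorphM, rmorphB, rmorph1)/=.
  by move=> /eqP; rewrite subr_eq => /eqP ->; ring.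
have rq01 : 0 <= r n * q < 1.
  by apply/andP; split; [exact: mulr_ge0 rn0 (ltW q0) | exact: le_lt_trans rq q1].
have := resolvent_le T_le rq01 gl.
have p0 : 0 <= (1 - r n) * q by rewrite mulr_ge0 ?subr_ge0 ?ltW.
rewrite rnormZ rnormN rnormC (ger0_norm p0) => h.
have : (1 - q) * rnorm (g n - l) <= (1 - r n) * q * rnorm l.
  apply: le_trans (le_trans h _); first by rewrite ler_wpM2r ?rnorm_ge0// lerB.
  exact: ler_wpM2l p0 _ _ (T_le _).
by rewrite mulrC -ler_pdivlMr// => /le_trans; apply; rewrite le_eqVlt; apply/orP; left;
  apply/eqP; ring.
Qed.

End ResolventLimit.

Section Approximation.
Variables (R : realType) (q : R) (N : nat) (A : starAlg R) (u : 'M[A]_N).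
Hypotheses (hq : 0 < q < 1) (hA : is_SUq q u).

Let q0 : 0 < q. Proof. by case/andP: hq. Qed.

(** * The corner generator and its commutation relations *)

Section Step.
Variables (H : hilbert R) (pi : starRep A H) (m : 'I_N).
Local Notation T := (pi (u m m)).
Local Notation c := (q%:C^-1 - q%:C : R[i]).

Lemma corner_comm (j : 'I_N) (x : H) : (j < m)%N ->
  pi (u j m) (T x) = q%:C *: T (pi (u j m) x) /\
  pi (u m j) (T x) = q%:C *: T (pi (u m j) x).
Proof.
move=> jm; have [r1 r2 _ _ _] := suq_rel hA.
by rewrite -!repM (r1 j m m)// (r2 m j m)// !repZ.
Qed.

Lemma corner_comm_block (j k : 'I_N) (x : H) : (j < m)%N -> (k < m)%N ->
  T (pi (u j k) x) = pi (u j k) (T x) + c *: pi (u j m) (pi (u m k) x).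
Proof.
move=> jm km; have [_ _ _ r4 _] := suq_rel hA.
by rewrite -!repM (r4 j m k m)// repB repZ subrK.
Qed.

(** By q-commutation each of the two vectors satisfies y = q T y, and q T is a strict
    contraction. *)
Lemma corner_fixed (j : 'I_N) (x : H) : (j < m)%N -> T x = x ->
  pi (u j m) x = 0 /\ pi (u m j) x = 0.
Proof.
move=> jm Tx; have [e1 e2] := corner_comm x jm.
suff fix0 y : y = q%:C *: T y -> y = 0 by split; apply: fix0; rewrite -?e1 -?e2 Tx.
move=> yE; apply: rnorm_le0; have := rep_u_le pi hq hA m m y.
have := congr1 (@rnorm R H) yE; rewrite rnormZ rnormC gtr0_norm//.
have := rnorm_ge0 y; case/andP: hq; move: (rnorm y) (rnorm _) => a b; nra.
Qed.

Variable eta : {linear A -> H}.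
Hypothesis eta_coc : cocycle pi eta.
Local Notation h := (eta (u m m)).

(** This is [eta] applied to the q-commutation with [u m m]; the counit vanishes on [u j m] and
    [u m j], so [h] determines [eta] there. *)
Lemma corner_coc (j : 'I_N) : (j < m)%N ->
  resolvent_eq T q (eta (u j m)) (- pi (u j m) h) /\
  resolvent_eq T q (eta (u m j)) (- pi (u m j) h).
Proof.
move=> jm; have [r1 r2 _ _ _] := suq_rel hA.
have jm' : (j == m) = false by apply/eqP => jE; rewrite jE ltnn in jm.
have := congr1 eta (r1 j m m jm); have := congr1 eta (r2 m j m jm).
rewrite !linearZ/= !eta_coc !(suq_counit hA) eqxx jm' eq_sym jm' !scale1r !scale0r !addr0.
by move=> e2 e1; split; rewrite /resolvent_eq -?e1 -?e2 opprD addrCA subrr addr0.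
Qed.

Lemma corner_coc_block (j k : 'I_N) : (j < m)%N -> (k < m)%N ->
  eta (u j k) - T (eta (u j k)) =
  (j == k)%:R *: h - pi (u j k) h - c *: pi (u j m) (eta (u m k)).
Proof.
move=> jm km; have [_ _ _ r4 _] := suq_rel hA.
have km' : (m == k) = false by apply/eqP => jE; rewrite -jE ltnn in km.
have := congr1 eta (r4 j m k m jm km).
rewrite linearB linearZ/= !eta_coc !(suq_counit hA) eqxx km' scale1r scale0r addr0.
move=> e; apply: ip_ext => z; have /(congr1 (ip z)) := e.
rewrite !(ipDr, ipNr, ipZr) => e'.
rewrite -[ip z (eta (u j k))](addKr (ip z (pi (u j k) h))) e'; ring.
Qed.

Hypothesis trivial_pi : forall j k : 'I_N, (m < maxn j k)%N ->
  forall x, pi (u j k) x = (j == k)%:R *: x.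
Hypothesis trivial_eta : forall j k : 'I_N, (m < maxn j k)%N -> eta (u j k) = 0.
Hypothesis T_inj : forall x, T x = x -> x = 0.

Lemma corner_approximable : approximable pi eta.
Proof.
have [r r01 r1] : exists2 r : nat -> R, forall n, 0 <= r n < 1 &
    (fun n => 1 - r n) @ \oo --> (0 : R).
  exists (fun n => 1 - n.+1%:R^-1) => [n|].
    by rewrite subr_ge0 invf_le1 ?ltr0n// ler1n /= ltrBlDr ltrDl invr_gt0 ltr0n.
  by under eq_fun do rewrite opprB addrCA subrr addr0; exact: harmonic0.
have T_le := rep_u_le pi hq hA m m.
have rq01 n : 0 <= r n * q < 1.
  have /andP[rn0 rn1] := r01 n; case/andP: hq => _ q1.
  apply/andP; split; first exact: mulr_ge0 rn0 (ltW q0).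
  by apply: le_lt_trans q1; apply: ler_piMl; exact: ltW.
have T_adj x y : ip (pi (star (u m m)) x) y = ip x (T y) by exact: rep_star.
have to0 (w x : nat -> H) l : tends x l ->
    (forall n, resolvent_eq T (r n) (w n) ((1 - r n)%:C *: x n)) -> tends w 0.
  exact: (ergodic T_le T_adj T_inj r01 r1).
have /choice[v vP] n : exists v, resolvent_eq T (r n) v (- h).
  exact: (resolvent_ex T_le _ (r01 n)).
(* Moving [pi a] past [T] in the equation for [v n] multiplies the parameter by q. *)
have off_tends a : resolvent_eq T q (eta a) (- pi a h) ->
    (forall x, pi a (T x) = q%:C *: T (pi a x)) ->
    (forall n, resolvent_eq T (r n * q) (pi a (v n)) (- pi a h)) /\
    tends (fun n => pi a (v n)) (eta a).
  move=> eta_a aT; suff vE n : resolvent_eq T (r n * q) (pi a (v n)) (- pi a h).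
    by split=> //; exact: (resolvent_tends T_le hq r01 r1 eta_a vE).
  have := congr1 (pi a) (vP n); rewrite linearB linearZ/= aT scalerA linearN.
  by rewrite /resolvent_eq rmorphM.
have block_tends0 (w : nat -> H) l : tends (fun n => w n - l) 0 -> tends w l.
  by move=> wl; apply: squeeze0 wl => n; rewrite subr0 rnorm_ge0 lexx.
apply: (gen_approximable hA eta_coc (v := v)) => j k.
have [mjk|] := ltnP m (maxn j k).
  rewrite trivial_eta//; apply: eq_tends _ (tends_cst _) => n.
  by rewrite trivial_pi// subrr.
rewrite geq_max => /andP[].
rewrite leq_eqVlt => /predU1P[/val_inj ->|jm].
  rewrite leq_eqVlt => /predU1P[/val_inj ->|km].
    rewrite eqxx; under eq_fun do rewrite scale1r.
    (* The equation for [v n] gives T v - v - h = (1 - r) T v, which is (1 - r) (1 - r T)^-1 applied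
       to - T h. *)
    apply: block_tends0; apply: (to0 _ _ (- T h) (tends_cst _)) => n.
    apply: ip_ext => z; have := vP n; rewrite /resolvent_eq => vE.
    have /(congr1 (fun x => ip z (T x))) := vE; have /(congr1 (ip z)) := vE.
    rewrite !(repDr, repNr, repZr) !(ipDr, ipNr, ipZr) rmorphB/= rmorph1.
    move=> /eqP; rewrite subr_eq => /eqP -> /eqP; rewrite subr_eq => /eqP ->; ring.
  have [_ eta_a] := corner_coc km; have [_ ] := off_tends _ eta_a (fun x => (corner_comm x km).2).
  apply: eq_tends => n; rewrite (_ : (m == k) = false) ?scale0r ?subr0//.
  by apply/eqP => mk; rewrite -mk ltnn in km.
rewrite leq_eqVlt => /predU1P[/val_inj ->|km].
  have [eta_a _] := corner_coc jm; have [_ ] := off_tends _ eta_a (fun x => (corner_comm x jm).1).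
  apply: eq_tends => n; rewrite (_ : (j == m) = false) ?scale0r ?subr0//.
  by apply/eqP => mk; rewrite mk ltnn in jm.
have [_ eta_mk] := corner_coc km.
have [mk_v _] := off_tends _ eta_mk (fun x => (corner_comm x km).2).
set y := eta (u m k) in eta_mk; set z := eta (u j k).
have [gl glP] := resolvent_ex T_le y (introT andP (conj (ltW q0) (proj2 (andP hq)))).
have r1C n : (1 - r n)%:C != 0 :> R[i].
  by rewrite (inj_eq (@complexI _)) subr_eq0 gt_eqF; case/andP: (r01 n).
(* The vector x = u_mk v_n solves (1 - r q T) x = y - q T y, so 1 - r q T maps y - r x to (1 - r) y.
   Hence [g n] is the resolvent of [y] at r q and converges despite the division by 1 - r. *)
have /choice[g gE] n : exists g, (1 - r n)%:C *: g = y - (r n)%:C *: pi (u m k) (v n).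
  exists ((1 - r n)%:C^-1 *: (y - (r n)%:C *: pi (u m k) (v n))).
  by rewrite scalerA divff// scale1r.
have gP n : resolvent_eq T (r n * q) (g n) y.
  apply: (scalerI (r1C n)); rewrite scalerBr scalerA (mulrC (1 - r n)%:C) -scalerA -repZr !gE.
  have := mk_v n; rewrite /resolvent_eq -eta_mk => vE.
  apply: ip_ext => x; have /(congr1 (ip x)) := vE.
  rewrite !(repDr, repNr, repZr) !(ipDr, ipNr, ipZr) !(rmorphM, rmorphB, rmorph1)/=.
  by move=> /eqP; rewrite subr_eq => /eqP ->; ring.
have g_gl : tends g gl by exact: (resolvent_tends T_le hq r01 r1 glP gP).
(* Applying 1 - r T to the difference, the correction term of the block relation and the one in
   [corner_coc_block] combine to c u_jm (y - r u_mk v_n) = (1 - r) c u_jm g_n. *)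
apply: block_tends0; apply: (to0 _ (fun n => c *: pi (u j m) (g n) - T z)).
  by apply: tendsB (tendsZ _ (tends_rep _ _ g_gl)) (tends_cst _).
move=> n; apply: ip_ext => x.
have vE := vP n; have /(congr1 (fun y => ip x (pi (u j k) y))) := vE.
have /(congr1 (ip x)) := vE.
have /(congr1 (ip x)) := corner_coc_block jm km.
have /(congr1 (fun y => ip x (pi (u j m) y))) := gE n.
have /(congr1 (ip x)) := corner_comm_block (v n) jm km.
rewrite -/y -/z !(repDr, repNr, repZr) !(ipDr, ipNr, ipZr) rmorphB/= rmorph1.
move=> -> gg /eqP; rewrite subr_eq => /eqP -> /eqP; rewrite subr_eq => /eqP ->.
move=> /eqP; rewrite subr_eq => /eqP ->.
by rewrite [RHS]mulrBr [X in _ = X - _]mulrCA gg; ring.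
Qed.

End Step.

(** * Induction on the non-trivial block *)

Lemma fixed_lin (H : hilbert R) (T : {linear H -> H}) : [set x | T x = x] 0 /\
  (forall (c : R[i]) x y, [set x | T x = x] x -> [set x | T x = x] y ->
    [set x | T x = x] (c *: x + y)).
Proof. by split=> [|c x y /= Tx Ty]; rewrite /= ?linear0// linearP Tx Ty. Qed.

Lemma fixed_closed (H : hilbert R) (pi : starRep A H) a : closed [set x | pi a x = x].
Proof.
have -> : [set x | pi a x = x] = (fun x => pi (a - 1) x) @^-1` [set 0].
  apply/seteqP; split=> x /=; rewrite repB rep1; last by move/subr0_eq.
  by move=> ->; rewrite subrr.
apply: (continuous_closedP _).1 [set 0] _; first exact: rep_cont.
apply: accessible_closed_set1; apply: hausdorff_accessible; exact: norm_hausdorff.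
Qed.

Lemma tends_csub (H : hilbert R) (S : closedSubspace H) (x : nat -> subhilbert S) l :
  tends x l -> tends (fun n => csub_val (x n)) (csub_val l).
Proof.
apply: tends_le => n; rewrite -csub_valB.
exact: lexx.
Qed.

(** Indices start at 0: [m] is the size of the block that may act non-trivially, and in the
    induction step the corner of a block of size [m.+1] is [m']. Complete non-gaussianity is
    expressed by vectors fixed by the generators, a form that passes directly to invariant
    subspaces. *)
Lemma trivial_approximable m (H : hilbert R) (pi : starRep A H) (eta : {linear A -> H}) :
  (m <= N)%N -> cocycle pi eta ->
  (forall x, (forall j k, pi (u j k) x = (j == k)%:R *: x) -> x = 0) ->
  (forall j k : 'I_N, (m <= maxn j k)%N -> forall x, pi (u j k) x = (j == k)%:R *: x) ->
  (forall j k : 'I_N, (m <= maxn j k)%N -> eta (u j k) = 0) ->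
  approximable pi eta.
Proof.
elim: m H pi eta => [|m IH] H pi eta mN eta_coc pi_ng pi_triv eta_triv.
  apply: (gen_approximable hA eta_coc (v := fun=> 0)) => j k.
  rewrite eta_triv//; apply: eq_tends _ (tends_cst _) => n.
  by rewrite linear0 scaler0 subrr.
pose m' := Ordinal mN; pose t := u m' m'.
pose E := ClosedSubspace (fixed_lin (pi t)) (@fixed_closed _ pi t).
have mcase (j : 'I_N) : (j <= m)%N -> j = m' \/ (j < m')%N.
  by rewrite leq_eqVlt => /predU1P[jm|]; [left; apply: val_inj | right].
(* On vectors fixed by [t] the off-diagonal entries of row and column [m'] vanish, so the correction
   term in the commutation of [t] with the block drops out. *)
have invE : invariant_subspace pi E.
  apply: (gen_invariant hA) => j k x /= tx.
  have [mjk|] := ltnP m (maxn j k); first by rewrite pi_triv// linearZ/= tx.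
  rewrite geq_max => /andP[/mcase[->|jm] /mcase[->|km]]; first by rewrite !tx.
  - by have [_ ->] := corner_fixed km tx; rewrite linear0.
  - by have [-> _] := corner_fixed jm tx; rewrite linear0.
  - rewrite (corner_comm_block pi x jm km) tx.
    by have [_ ->] := corner_fixed km tx; rewrite linear0 scaler0 addr0.
have invO := ortho_inv invE.
have [coc1 coc2] := cocycle_proj invE invO eta_coc.
have eta_triv1 (j k : 'I_N) : (m < maxn j k)%N ->
    (proj E \o eta) (u j k) = 0 /\ (coproj E \o eta) (u j k) = 0.
  by move=> mjk /=; rewrite eta_triv// !linear0.
(* A vector of the complement of [E] fixed by [t] also lies in [E], hence is 0. *)
have [v2 v2P] : approximable (restr invO) (coproj E \o eta).
  apply: (@corner_approximable _ _ m') => //.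
  - by move=> j k mjk x; apply: val_inj; rewrite /= pi_triv// linearZ.
  - by move=> j k mjk; have [] := eta_triv1 j k mjk.
  - move=> x tx; apply: val_inj; apply: (csub_ortho (S := E)).
      exact: (congr1 (@csub_val _ _ _) tx).
    exact: (csub_valP x).
have tE (x : subhilbert E) : restr invE t x = x.
  by apply: val_inj; exact: (csub_valP x).
have killE (j : 'I_N) (x : subhilbert E) : (j < m')%N ->
    restr invE (u j m') x = 0 /\ restr invE (u m' j) x = 0.
  by move=> jm; exact: (corner_fixed jm (tE x)).
have q1 : (1 - q%:C : R[i]) != 0.
  by apply/eqP => /(congr1 (@complex.Re R))/=; case/andP: hq; lra.
have neq_m (j : 'I_N) : (j < m')%N -> (j == m') = false.
  by move=> jm; apply/eqP => jE; rewrite jE ltnn in jm.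
(* With [t] acting as the identity, [corner_coc] reduces to (1 - q) eta = 0. *)
have eta_kill (j : 'I_N) : (j < m')%N ->
    (proj E \o eta) (u j m') = 0 /\ (proj E \o eta) (u m' j) = 0.
  move=> jm; have [e1 e2] := corner_coc coc1 jm.
  have [k1 k2] := killE j ((proj E \o eta) t) jm.
  move: e1 e2; rewrite /resolvent_eq !tE k1 k2 oppr0 => e1 e2.
  by split; apply: (scalerI q1); rewrite scaler0 scalerBl scale1r.
have piE (j k : 'I_N) : (m <= maxn j k)%N ->
    forall x, restr invE (u j k) x = (j == k)%:R *: x.
  move=> mjk x; have [mjk'|] := ltnP m (maxn j k).
    by apply: val_inj; rewrite /= pi_triv// linearZ.
  rewrite geq_max => /andP[/mcase[jE|jm] /mcase[kE|km]].
  - by rewrite jE kE eqxx scale1r tE.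
  - by rewrite jE eq_sym neq_m// scale0r (killE _ _ km).2.
  - by rewrite kE neq_m// scale0r (killE _ _ jm).1.
  - by move: mjk; rewrite leqNgt gtn_max jm km.
have ngE (x : subhilbert E) :
    (forall j k, restr invE (u j k) x = (j == k)%:R *: x) -> x = 0.
  move=> xu; apply: val_inj; apply: pi_ng => j k.
  by have := congr1 (@csub_val _ _ E) (xu j k); rewrite csub_valZ.
have [v1 v1P] : approximable (restr invE) (proj E \o eta).
  apply: IH => //; first exact: ltnW.
  move=> j k mjk; have [mjk'|] := ltnP m (maxn j k); first by have [] := eta_triv1 j k mjk'.
  rewrite geq_max => /andP[/mcase[jE|jm] /mcase[kE|km]].
  (* On [E], [corner_coc_block] says that each block generator acts on eta u_mm by its counit. The
     other generators do so by [piE], so the vector is 0. *)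
  - rewrite jE kE; apply: ngE => {mjk} i l.
    have [mil|] := leqP m (maxn i l); first exact: piE.
    rewrite gtn_max => /andP[im lm].
    have := corner_coc_block coc1 (im : (i < m')%N) (lm : (l < m')%N).
    rewrite tE subrr (killE _ _ im).1 scaler0 subr0 => /esym/subr0_eq.
    by [].
  - by rewrite jE; exact: (eta_kill _ km).2.
  - by rewrite kE; exact: (eta_kill _ jm).1.
  - by move: mjk; rewrite leqNgt gtn_max jm km.
exists (fun n => csub_val (v1 n) + csub_val (v2 n)) => a.
rewrite -(proj_coproj E (eta a)).
apply: eq_tends _ (tendsD (tends_csub (v1P a)) (tends_csub (v2P a))) => n.
rewrite !csub_valB !csub_valZ /=.
by rewrite linearD scalerDr addrACA opprD.
Qed.

(** For the full block the triviality hypotheses are vacuous. A vector on which all generators act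
    by the counit lies in [gauss pi], which is 0. *)
Lemma approximable_of_nongaussian (H : hilbert R) (pi : starRep A H) (eta : {linear A -> H}) :
  completely_nongaussian pi -> cocycle pi eta -> approximable pi eta.
Proof.
move=> ng eta_coc.
have big (j k : 'I_N) : (N <= maxn j k)%N = false.
  by apply/negbTE; rewrite -ltnNge gtn_max !ltn_ord.
apply: (@trivial_approximable N) => //; last first.
- by move=> j k; rewrite big.
- by move=> j k; rewrite big.
move=> x xu; have xfix := gen_fixed hA xu.
suff /seteqP[/(_ x) + _] : (gauss pi : set H) = [set 0].
  by apply=> a Ka; rewrite /= xfix [counit A a]Ka scale0r.
apply: (ng _ (@gauss_inv _ _ _ pi)) => a Ka y; apply: val_inj; rewrite /=.
exact: (csub_valP y).
Qed.

End Approximation.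

(** * Functionals from approximable cocycles *)

Section LinearExtension.
Variables (K : fieldType) (V : lmodType K) (G : set (V * K)).

Definition linrel (X : set (V * K)) := X 0 /\
  forall c a b, X a -> X b -> X (c *: a.1 + b.1, c * a.2 + b.2).

Definition funrel (X : set (V * K)) := forall k, X (0, k) -> k = 0.

(** [G] is the graph of a linear functional on a subspace; Zorn's lemma applied to such graphs
    extends it. *)
Lemma linrel_extend : linrel G -> funrel G ->
  exists f : {scalar V}, forall v k, G (v, k) -> f v = k.
Proof.
move=> [G0 GD] GF.
(* Uniting with [G] makes the condition hold for the union of the empty chain. *)
pose P (X : set (V * K)) := linrel (X `|` G) /\ funrel (X `|` G).
have [F FP totF|A [[AL AF] Amax]] := @Zorn_bigcup _ P.
  have sub X : F X -> X `|` G `<=` \bigcup_(Y in F) Y `|` G.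
    by move=> FX a [Xa|]; [left; exists X | right].
  have FG (X Y : set (V * K)) : F X -> F Y -> exists2 Z, F Z & X `|` Y `<=` Z.
    move=> FX FY; have [XY|YX] := totF _ _ FX FY; [exists Y|exists X] => // a [] //.
      exact: XY.
    exact: YX.
  split; first split; first by right.
    move=> c a b [[X FX Xa]|Ga] [[Y FY Yb]|Gb].
    - have [Z FZ XYZ] := FG X Y FX FY; apply: (sub Z FZ).
      by apply: (FP Z FZ).1.2; left; apply: XYZ; [left|right].
    - by apply: (sub X FX); apply: (FP X FX).1.2; [left|right].
    - by apply: (sub Y FY); apply: (FP Y FY).1.2; [right|left].
    - by right; exact: GD.
  by move=> k [[X FX Xk]|/GF//]; apply: (FP X FX).2; left.
pose M := A `|` G; have [M0 MD] := AL.
have Mtot e : exists k, M (e, k).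
  apply: contrapT => /forallNP eM.
  (* The graph is enlarged by giving the missing vector [e] the value 0. *)
  pose X := [set a : V * K | exists d b, M b /\ a = (d *: e + b.1, b.2)].
  have MX : M `<=` X by move=> [v k] Ma; exists 0, (v, k); rewrite scale0r add0r.
  have XG : X `|` G = X.
    by apply/seteqP; split=> a; [case=> // Ga; apply: MX; right | left].
  apply: (Amax X); first split.
    - by move=> a Aa; apply: MX; left.
    - move=> XA; have : A (e, 0).
        by apply: XA; exists 1, 0; split => //; rewrite scale1r addr0.
      by move=> Ae; apply: (eM 0); left.
  rewrite /P XG; split; first split.
  - exact: MX.
  - move=> c _ _ [d [a [Ma ->]]] [d' [b [Mb ->]]]; exists (c * d + d').
    exists (c *: a.1 + b.1, c * a.2 + b.2); split; first exact: MD.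
    by rewrite /= scalerDr scalerDl scalerA addrACA.
  - move=> k [d [[v k'] [Ma [ev ->]]]].
    have [d0|d0] := eqVneq d 0.
      by move: ev; rewrite d0 scale0r add0r /= => v0; apply: AF; move: Ma; rewrite -v0.
    (* From d e + v = 0 and (v, k') in [M], linearity puts (e, - k'/d) in [M]. *)
    exfalso; apply: (eM (- d^-1 * k')); have := MD (- d^-1) _ _ Ma M0.
    rewrite /= !addr0; suff -> : - d^-1 *: v = e by [].
    move/eqP: ev; rewrite eq_sym addrC addr_eq0 => /eqP ->.
    by rewrite scalerN scaleNr opprK scalerA mulVf// scale1r.
have /choice[f fM] := Mtot.
have MU v k : M (v, k) -> f v = k.
  move=> Mvk; apply/subr0_eq/AF; have := MD (-1) _ _ Mvk (fM v).
  by rewrite /= scaleN1r mulN1r addNr addrC.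
have f_lin : scalar f.
  by move=> c x y; apply: MU; have := MD c _ _ (fM x) (fM y).
pose g : {scalar V} := HB.pack f (GRing.isLinear.Build K V K *%R f f_lin).
by exists g => v k Gvk; apply: MU; right.
Qed.

End LinearExtension.

Section Functional.
Variables (R : realType) (A : starAlg R) (H : hilbert R) (pi : starRep A H).

Lemma approximable_triple (eta : {linear A -> H}) : cocycle pi eta -> approximable pi eta ->
  exists psi : {scalar A}, schurmann_triple pi eta psi.
Proof.
move=> eta_coc [v vP].
pose eta_ n a := pi a (v n) - counit A a *: v n.
pose psi_ n a := ip (v n) (eta_ n a).
(* The graph of the limit of the [psi_ n] on the subspace where it exists. *)
pose G := [set a : A * R[i] | tends (fun n => psi_ n a.1) a.2].
have psiD n c a b : psi_ n (c *: a + b) = c * psi_ n a + psi_ n b.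
  rewrite /psi_ /eta_ repP linearP !(ipDr, ipNr, ipZr); ring.
have psi0 n : psi_ n 0 = 0.
  by rewrite /psi_ /eta_ rep0 linear0 scale0r subr0 ip0.
have [||psi psiP] := @linrel_extend _ _ G.
- split.
    by apply: eq_tends _ (tends_cst _) => n; rewrite /= psi0.
  move=> c [a k] [b l] /= ak bl; rewrite /G /=.
  by apply: eq_tends _ (tendsD (tendsM (tends_cst c) ak) bl) => n; rewrite psiD.
- move=> k /= k0; apply: (tends_unique k0).
  by apply: eq_tends _ (tends_cst _) => n; rewrite psi0.
have psi1 : psi 1 = 0.
  apply: psiP; apply: eq_tends _ (tends_cst _) => n.
  by rewrite /psi_ /eta_ rep1 rmorph1 scale1r subrr ip0.
exists psi; split=> // a b.
(* [z] is the product of star (a - eps a) and b - eps b, on which [psi_ n] equals <eta_n a, eta_n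
   b>. As psi 1 = 0, its value under [psi] is the right-hand side of the triple. *)
pose z := star a * b - counit A b *: star a - counit A (star a) *: b
  + (counit A (star a) * counit A b) *: 1.
have <- : psi z = psi (star a * b) - psi (star a) * counit A b - counit A (star a) * psi b.
  have psiZ c x : psi (c *: x) = c * psi x by exact: linearZ.
  by rewrite /z linearD !linearB !psiZ psi1 mulr0 addr0 (mulrC (counit A b)).
symmetry; apply: psiP; apply: eq_tends _ (tends_ip (vP a) (vP b)) => n.
rewrite /= /psi_ /eta_ /z !(repB, repD, repZ, rep1, repM).
have epsZ c x : counit A (c *: x) = c * counit A x by exact: linearZ.
rewrite rmorphD !rmorphB/= !epsZ !rmorphM/= rmorph1 (counit_star a).
have adj x y : ip (pi a x) y = ip x (pi (star a) y) by rewrite -rep_star starK.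
rewrite !(ipBl, ipDr, ipNr, ipZl, ipZr) !adj.
ring.
Qed.

End Functional.

(** * Completion of a semi-inner product *)

Lemma tends_ge0 (R : realType) (x : nat -> R[i]) l : tends x l ->
  (forall n, 0 <= complex.Re (x n)) -> 0 <= complex.Re l.
Proof.
move=> xl x0; rewrite -oppr_le0; apply: (le_cvg0 _ xl) => n; rewrite add0r.
apply: le_trans (_ : complex.Re (x n - l) <= _).
  by rewrite raddfB/= lerDr.
exact: le_trans (ler_norm _) (Re_le_rnorm _).
Qed.

Lemma cauchy_tendsC (R : realType) (x : nat -> R[i]) (e : nat -> R) :
  (forall n m, (n <= m)%N -> rnorm (x n - x m) <= e n) ->
  e @ \oo --> (0 : R) -> exists l, tends x l.
Proof.
move=> xe e0.
have real (y : nat -> R) : (forall n m, (n <= m)%N -> `|y n - y m| <= e n) ->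
    exists l, (fun n => `|y n - l|) @ \oo --> (0 : R).
  move=> ye; have : cvg (y @ \oo).
    apply: cauchy_cvg; apply/cauchyP => d d0.
    have [n0 _ en] := (cvgr0Pnorm_lt _).1 e0 _ d0; exists (y n0); exists n0 => // n n0n.
    rewrite -ball_normE /ball_/=; apply: le_lt_trans (ye _ _ n0n) _.
    by apply: le_lt_trans (ler_norm _) _; exact: en n0 (leqnn _).
  move=> /cvg_ex[l yl]; exists l; apply/cvgr0Pnorm_lt => d d0.
  move/cvgrPdist_lt: yl => /(_ _ d0)[n0 _ yn]; exists n0 => // n /yn /=.
  by rewrite normr_id distrC.
have Im_le (z : R[i]) : `|complex.Im z| <= rnorm z.
  by have := Re_le_rnorm (z * 'i); rewrite ReiNIm normrN rnormM /rnorm normCi mulr1.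
have [|a xa] := real (fun n => complex.Re (x n)).
  by move=> n m nm; apply: le_trans (xe n m nm); rewrite -raddfB; exact: Re_le_rnorm.
have [|b xb] := real (fun n => complex.Im (x n)).
  by move=> n m nm; apply: le_trans (xe n m nm); rewrite -raddfB; exact: Im_le.
exists (a +i* b); apply: tends_le (cvg0D xa xb) => n.
case: (x n) => c d; rewrite /rnorm normc_def/= -[leRHS]ger0_norm ?addr_ge0//.
rewrite -[leRHS]sqrtr_sqr ler_wsqrtr// [leRHS]sqrrD !real_normK ?num_real//.
by rewrite addrAC lerDl mulrn_wge0// mulr_ge0.
Qed.

Section Completion.
Variables (R : realType) (V : lmodType R[i]) (B : semi_dot V).
Implicit Types (x y z : V) (s t : nat -> V) (f g : V -> R[i]) (e : nat -> R).

(** In the norm dual to [snorm B], [f] is within [e n] of the functional y |-> <y, s n>. *)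
Definition approx f s e :=
  forall n y, rnorm (f y - B y (s n)) <= e n * snorm B y.

(** One rate is fixed for all elements; [approx_compl] reaches it from any null rate by
    reindexing. *)
Definition compl_set f := exists s, approx f s (fun n => n.+1%:R^-1).

Lemma snorm_dual C z : 0 <= C ->
  (forall y, rnorm (B y z) <= C * snorm B y) -> snorm B z <= C.
Proof.
move=> C0 zC; have [->//|z0] := eqVneq (snorm B z) 0.
have z0' : 0 < snorm B z by rewrite lt_def z0 snorm_ge0.
by rewrite -(ler_pM2r z0'); have := zC z; rewrite -snorm_sqr rnormC ger0_norm ?exprn_ge0 ?snorm_ge0.
Qed.

Lemma approx_comb c f g s s' e e' : approx f s e -> approx g s' e' ->
  approx (fun y => c * f y + g y) (fun n => c *: s n + s' n)
    (fun n => rnorm c * e n + e' n).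
Proof.
move=> fx gx n y; rewrite sdot_lin opprD addrACA -mulrBr.
apply: le_trans (rnormD _ _) _; rewrite rnormM mulrDl -mulrA lerD//.
by rewrite ler_wpM2l ?rnorm_ge0.
Qed.

Lemma approx_compl f s e : approx f s e -> e @ \oo --> (0 : R) -> compl_set f.
Proof.
move=> fx /cvgr0Pnorm_lt e0.
have /choice[k kP] n : exists k, e k <= n.+1%:R^-1.
  have [|k _ ek] := e0 n.+1%:R^-1; first by rewrite invr_gt0.
  by exists k; apply: le_trans (ler_norm _) (ltW _); exact: ek k (leqnn _).
exists (fun n => s (k n)) => n y; apply: le_trans (fx _ _) _.
by rewrite ler_wpM2r ?snorm_ge0.
Qed.

Lemma approx_dist f s e s' e' : approx f s e -> approx f s' e' ->
  forall n m, snorm B (s n - s' m) <= `|e n| + `|e' m|.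
Proof.
move=> fx fx' n m; apply: snorm_dual => [|y]; first by rewrite addr_ge0.
rewrite sdotBr; apply: le_trans (rdistD (f y) _ _) _; rewrite rdistC.
apply: le_trans (lerD (fx _ _) (fx' _ _)) _; rewrite mulrDl.
by rewrite lerD// ler_wpM2r ?snorm_ge0 ?ler_norm.
Qed.

Definition conj_linear f := forall c x y, f (c *: x + y) = Num.conj c * f x + f y.

Lemma compl_conj_linear f : compl_set f -> conj_linear f.
Proof.
move=> [z fz] c x y; apply/subr0_eq/rnorm_le0.
pose K := snorm B (c *: x + y) + rnorm c * snorm B x + snorm B y.
apply: (le_cvg0 _ (cvg0M K (@harmonic0 R))) => n; rewrite add0r.
have -> : f (c *: x + y) - (Num.conj c * f x + f y) =
    (f (c *: x + y) - B (c *: x + y) (z n)) - (Num.conj c * (f x - B x (z n)) + (f y - B y (z n))).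
  rewrite sdotDl sdotZl; ring.
apply: le_trans (rnormB _ _) _; rewrite /K -addrA mulrDl.
apply: lerD; first by rewrite [leRHS]mulrC.
apply: le_trans (rnormD _ _) _; rewrite mulrDl.
apply: lerD; last by rewrite [leRHS]mulrC.
by rewrite rnormM rnorm_conj -mulrA ler_wpM2l ?rnorm_ge0// [leRHS]mulrC.
Qed.

Lemma compl_bounded f : compl_set f ->
  exists2 C, 0 <= C & forall y, rnorm (f y) <= C * snorm B y.
Proof.
move=> [z fz]; exists (1 + snorm B (z 0%N)); first by rewrite addr_ge0 ?snorm_ge0.
move=> y; rewrite -[f y](subrK (B y (z 0%N))); apply: le_trans (rnormD _ _) _.
rewrite mulrDl lerD//; first by have := fz 0%N y; rewrite invr1.
by rewrite mulrC sdot_cauchy.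
Qed.

Lemma compl_sub f x y : compl_set f -> f (x - y) = f x - f y.
Proof.
by move=> /compl_conj_linear fl; rewrite addrC -scaleN1r fl rmorphN rmorph1 mulN1r addrC.
Qed.

(* An element [f] of the completion of [V] is realized as the antilinear
   functional [y |-> <y, f>]. *)
Record compl_type := Compl {
  compl_val : V -> R[i];
  compl_valP : compl_set compl_val
}.
Implicit Types F G L : compl_type.

HB.instance Definition _ := gen_eqMixin compl_type.
HB.instance Definition _ := gen_choiceMixin compl_type.

Lemma compl_ext F G : compl_val F =1 compl_val G -> F = G.
Proof.
case: F G => [f fP] [g gP] /= /funext fg; rewrite {}fg in fP *.
by congr Compl; exact: Prop_irrelevance.
Qed.

Lemma compl_comb_subproof c F G :
  compl_set (fun y => c * compl_val F y + compl_val G y).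
Proof.
have [s Fs] := compl_valP F; have [t Gt] := compl_valP G.
apply: (approx_compl (approx_comb c Fs Gt)).
by apply: cvg0D (@harmonic0 R); exact: cvg0M (@harmonic0 R).
Qed.

Definition compl_comb c F G : compl_type := Compl (compl_comb_subproof c F G).

Lemma compl0_subproof : compl_set (fun=> 0).
Proof.
exists (fun=> 0) => n y.
by rewrite sdot0r subrr rnorm0 mulr_ge0 ?snorm_ge0.
Qed.

Definition compl0 : compl_type := Compl compl0_subproof.
Definition compl_add F G := compl_comb 1 F G.
Definition compl_opp F := compl_comb (-1) F compl0.
Definition compl_scale c F := compl_comb c F compl0.

Lemma compl_addA : associative compl_add.
Proof. by move=> F G L; apply: compl_ext => y /=; rewrite !mul1r addrA. Qed.

Lemma compl_addC : commutative compl_add.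
Proof. by move=> F G; apply: compl_ext => y /=; rewrite !mul1r addrC. Qed.

Lemma compl_add0 : left_id compl0 compl_add.
Proof. by move=> F; apply: compl_ext => y /=; rewrite mul1r add0r. Qed.

Lemma compl_addN : left_inverse compl0 compl_opp compl_add.
Proof. by move=> F; apply: compl_ext => y /=; rewrite mul1r addr0 mulN1r addNr. Qed.

HB.instance Definition _ := GRing.isZmodule.Build compl_type
  compl_addA compl_addC compl_add0 compl_addN.

Lemma compl_scaleA a b F : compl_scale a (compl_scale b F) = compl_scale (a * b) F.
Proof. by apply: compl_ext => y /=; rewrite !addr0 mulrA. Qed.

Lemma compl_scale1 : left_id 1 compl_scale.
Proof. by move=> F; apply: compl_ext => y /=; rewrite addr0 mul1r. Qed.

Lemma compl_scaleDr : right_distributive compl_scale +%R.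
Proof. by move=> c F G; apply: compl_ext => y /=; rewrite !mul1r !addr0 mulrDr. Qed.

Lemma compl_scaleDl F : {morph compl_scale^~ F : a b / a + b}.
Proof. by move=> a b; apply: compl_ext => y /=; rewrite !addr0 mul1r mulrDl. Qed.

HB.instance Definition _ := GRing.Zmodule_isLmodule.Build R[i] compl_type
  compl_scaleA compl_scale1 compl_scaleDr compl_scaleDl.

Lemma compl_val_comb c F G y :
  compl_val (c *: F + G) y = c * compl_val F y + compl_val G y.
Proof. by rewrite /= mul1r addr0. Qed.

Lemma compl_valB F G y : compl_val (F - G) y = compl_val F y - compl_val G y.
Proof. by rewrite addrC -scaleN1r compl_val_comb mulN1r addrC. Qed.

Definition appr F : nat -> V := sval (cid (compl_valP F)).

Lemma apprP F : approx (compl_val F) (appr F) (fun n => n.+1%:R^-1).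
Proof. exact: svalP (cid (compl_valP F)). Qed.

Lemma appr_dist F n m : (n <= m)%N -> snorm B (appr F n - appr F m) <= 2 * n.+1%:R^-1.
Proof.
move=> nm; apply: le_trans (approx_dist (apprP F) (apprP F) n m) _.
rewrite !ger0_norm ?invr_ge0// mulr_natl mulr2n lerD2l.
by rewrite lef_pV2 ?posrE// ler_nat ltnS.
Qed.

Lemma appr_bounded F : exists2 K, 0 <= K & forall n, snorm B (appr F n) <= K.
Proof.
exists (2 + snorm B (appr F 0%N)); first by rewrite addr_ge0 ?snorm_ge0.
move=> n; rewrite -[X in snorm _ X](subrK (appr F 0%N)).
apply: le_trans (snormD _ _ _) _; rewrite lerD2r snormBC.
by apply: le_trans (appr_dist F (leq0n n)) _; rewrite invr1 mulr1.
Qed.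

Lemma cdot_subproof F G : exists l, tends (fun n => compl_val F (appr G n)) l.
Proof.
have [C C0 FC] := compl_bounded (compl_valP F).
apply: (@cauchy_tendsC _ _ (fun n => C * 2 * n.+1%:R^-1)); last exact: cvg0M (@harmonic0 R).
move=> n m nm; rewrite -compl_sub; last exact: compl_valP.
by apply: le_trans (FC _) _; rewrite -mulrA ler_wpM2l// appr_dist.
Qed.

Definition cdot F G : R[i] := sval (cid (cdot_subproof F G)).

(** Two sequences approximating [G] come close by [approx_dist], so the limit defining [cdot] is
    independent of the choice. *)
Lemma cdotP F G s e : approx (compl_val G) s e -> e @ \oo --> (0 : R) ->
  tends (fun n => compl_val F (s n)) (cdot F G).
Proof.
move=> Gs e0; have Fl : tends _ (cdot F G) := svalP (cid (cdot_subproof F G)).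
have [C C0 FC] := compl_bounded (compl_valP F).
have e0' : (fun n => `|e n|) @ \oo --> (0 : R) by rewrite -(normr0 R); exact: cvg_norm.
have h0' : (fun n => `|n.+1%:R^-1|) @ \oo --> (0 : R).
  by rewrite -(normr0 R); apply: cvg_norm; exact: (@harmonic0 R).
apply: tends_le (cvg0D (cvg0M C (cvg0D e0' h0')) Fl) => n.
apply: le_trans (rdistD (compl_val F (appr G n)) _ _) _; rewrite lerD2r.
rewrite -compl_sub; last exact: compl_valP.
by apply: le_trans (FC _) _; rewrite ler_wpM2l// (approx_dist Gs (apprP G)).
Qed.

Lemma cdot_appr F G : tends (fun n => compl_val F (appr G n)) (cdot F G).
Proof. exact: cdotP (apprP G) (@harmonic0 R). Qed.

Lemma cdot_lin G c F L : cdot (c *: F + L) G = c * cdot F G + cdot L G.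
Proof.
apply: (tends_unique (cdot_appr _ G)).
apply: eq_tends _ (tendsD (tendsM (tends_cst c) (cdot_appr F G)) (cdot_appr L G)) => n.
by rewrite compl_val_comb.
Qed.

Lemma cdot_conj F G : cdot F G = Num.conj (cdot G F).
Proof.
have [K K0 FK] := appr_bounded F; have [K' K'0 GK'] := appr_bounded G.
apply: (tends_unique (cdot_appr F G)).
apply: tends_le (cvg0D (cvg0M (K + K') (@harmonic0 R)) (cdot_appr G F)) => n /=.
set s := appr G n; set t := appr F n; set l := cdot G F.
(* Both F s and the conjugate of G t are close to <s, t>. *)
have -> : compl_val F s - Num.conj l = (compl_val F s - B s t) -
    Num.conj (compl_val G t - B t s) + Num.conj (compl_val G t - l).
  by rewrite !rmorphB /= -(sdot_conj B s t); ring.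
apply: le_trans (rnormD _ _) _; rewrite rnorm_conj lerD2r.
apply: le_trans (rnormB _ _) _; rewrite rnorm_conj addrC mulrDl lerD//.
  apply: le_trans (apprP G n t) _; rewrite mulrC ler_wpM2r ?invr_ge0//; exact: FK.
apply: le_trans (apprP F n s) _; rewrite mulrC ler_wpM2r ?invr_ge0//; exact: GK'.
Qed.

Lemma cdot_ge0 F : 0 <= cdot F F.
Proof.
have [K K0 FK] := appr_bounded F.
have BF : tends (fun n => B (appr F n) (appr F n)) (cdot F F).
  apply: tends_le (cvg0D (cvg0M K (@harmonic0 R)) (cdot_appr F F)) => n.
  apply: le_trans (rdistD (compl_val F (appr F n)) _ _) _; rewrite lerD2r rdistC.
  apply: le_trans (apprP F n _) _; rewrite mulrC ler_wpM2r ?invr_ge0//; exact: FK.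
have Re0 : 0 <= complex.Re (cdot F F).
  by apply: (tends_ge0 BF) => n; rewrite -snorm_sqr /= exprn_ge0 ?snorm_ge0.
rewrite lecE /= Re0 andbT.
by have := cdot_conj F F; case: (cdot F F) => a b [] /eqP; rewrite -addr_eq0 -mulr2n mulrn_eq0.
Qed.

(** The arguments are swapped because [cdot] is linear in the first one. *)
Definition cdot_semi : semi_dot compl_type :=
  @SemiDot R compl_type (fun F G => cdot G F) cdot_lin (fun F G => cdot_conj G F) cdot_ge0.

Lemma embed_approx x : approx (fun y => B y x) (fun=> x) (fun=> 0).
Proof. by move=> n y; rewrite subrr rnorm0 mul0r. Qed.

Definition embed x : compl_type :=
  Compl (approx_compl (embed_approx x) (@cvg_cst _ _ _ _ _)).

Lemma cdot_embed F x : cdot F (embed x) = compl_val F x.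
Proof.
by apply: (tends_unique (cdotP F (embed_approx x : approx (compl_val (embed x)) _ _)
  (@cvg_cst _ _ _ _ _))); exact: tends_cst.
Qed.

Lemma compl_le F y : rnorm (compl_val F y) <= snorm cdot_semi F * snorm B y.
Proof.
rewrite -cdot_embed mulrC; apply: le_trans (sdot_cauchy cdot_semi (embed y) F) _.
by rewrite ler_wpM2r ?snorm_ge0// /snorm /= cdot_embed.
Qed.

(** |F|^2 is the limit of the values of [F] at [appr F n], which are bounded by C (C + 1/(n+1)).
    With [compl_le] this identifies the norm with the dual norm. *)
Lemma le_compl F C : 0 <= C -> (forall y, rnorm (compl_val F y) <= C * snorm B y) ->
  snorm cdot_semi F <= C.
Proof.
move=> C0 FC; rewrite -(ler_pXn2r (ltn0Sn 1)) ?nnegrE ?snorm_ge0//.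
rewrite -[leLHS]ger0_norm ?exprn_ge0 ?snorm_ge0// -rnormC snorm_sqr /=.
apply: (le_cvg0 _ (cvg0D (cvg0M C (@harmonic0 R)) (cdot_appr F F))) => n /=.
have tn : snorm B (appr F n) <= C + n.+1%:R^-1.
  apply: snorm_dual => [|y]; first by rewrite addr_ge0 ?invr_ge0.
  rewrite -[B y _](subKr (compl_val F y)) mulrDl.
  by apply: le_trans (rnormB _ _) _; apply: lerD; [exact: FC | exact: apprP].
rewrite -[X in rnorm X <= _](subKr (compl_val F (appr F n))) addrA.
apply: le_trans (rnormB _ _) _; rewrite lerD2r.
by apply: le_trans (FC _) _; rewrite expr2 -mulrDr ler_wpM2l.
Qed.

Definition compl_norm F : R[i] := (snorm cdot_semi F)%:C.

Lemma compl_normD F G : compl_norm (F + G) <= compl_norm F + compl_norm G.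
Proof. by rewrite -rmorphD lecR snormD. Qed.

Lemma compl_normZ c F : compl_norm (c *: F) = `|c| * compl_norm F.
Proof. by rewrite /compl_norm snormZ rmorphM /= -rnormE. Qed.

Lemma compl_norm0 F : compl_norm F = 0 -> F = 0.
Proof.
move=> /(@complexI _ _ 0) F0; apply: compl_ext => y.
by apply: rnorm_le0; have := compl_le F y; rewrite F0 mul0r.
Qed.

HB.instance Definition _ := Lmodule_isNormed.Build R[i] compl_type
  compl_normD compl_normZ compl_norm0.

Lemma compl_ballE F (e : R) G : ball F e%:C G = (snorm cdot_semi (F - G) < e) :> Prop.
Proof. by rewrite -ball_normE /= /ball_/= -ltcR. Qed.

(** Centres [G n] of balls of radius 1/(n+1) in the filter converge pointwise, and the limit is
    approximated by the diagonal sequence of their approximants. *)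
Lemma compl_cauchy_cvg (E : set_system compl_type) : ProperFilter E -> cauchy E -> cvg E.
Proof.
move=> EF Ec.
have /choice[G GP] n : exists G, E (ball G n.+1%:R^-1%:C).
  have /cauchyP/(_ n.+1%:R^-1%:C) := Ec.
  by apply; rewrite ltcR invr_gt0.
have Gdist n m : (n <= m)%N -> snorm cdot_semi (G n - G m) <= 2 * n.+1%:R^-1.
  move=> nm; have [L [Ln Lm]] := filter_ex (filterI (GP n) (GP m)).
  move: Ln Lm; rewrite !compl_ballE => Ln Lm.
  rewrite -[G n](subrK L) -addrA; apply: le_trans (snormD _ _ _) _.
  rewrite mulr_natl mulr2n lerD ?ltW// snormBC; apply: lt_le_trans Lm _.
  by rewrite lef_pV2 ?posrE// ler_nat ltnS.
have Gy y n m : (n <= m)%N ->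
    rnorm (compl_val (G n) y - compl_val (G m) y) <= 2 * n.+1%:R^-1 * snorm B y.
  move=> nm; rewrite -compl_valB; apply: le_trans (compl_le _ _) _.
  by rewrite ler_wpM2r ?snorm_ge0// Gdist.
have /choice[f fP] y : exists l, tends (fun n => compl_val (G n) y) l.
  apply: (@cauchy_tendsC _ _ (fun n => 2 * snorm B y * n.+1%:R^-1)).
    by move=> n m nm; rewrite mulrAC; exact: Gy.
  exact: cvg0M (@harmonic0 R).
have fG n y : rnorm (f y - compl_val (G n) y) <= 2 * n.+1%:R^-1 * snorm B y.
  apply: (le_cvg0 _ (_ : (fun m => rnorm (compl_val (G (n + m)%N) y - f y)) @ \oo --> (0 : R))).
    move=> m; rewrite rdistC.
    apply: le_trans (rdistD (compl_val (G (n + m)%N) y) _ _) _; rewrite lerD2r.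
    by apply: Gy; exact: leq_addr.
  have /tends_eps fy := fP y; apply/cvgr0Pnorm_lt => e e0.
  have [n0 yn] := fy e e0; exists n0 => // m /= n0m; rewrite ger0_norm ?rnorm_ge0//.
  by apply: yn; rewrite (leq_trans n0m)// leq_addl.
(* The rate is 2/(n+1) for the distance from [f] to [G n] plus 1/(n+1) for the approximant of
   [G n]. *)
have fapprox : approx f (fun n => appr (G n) n) (fun n => 3 * n.+1%:R^-1).
  move=> n y; apply: le_trans (rdistD (compl_val (G n) y) _ _) _.
  rewrite (_ : 3 * _ = 2 * n.+1%:R^-1 + n.+1%:R^-1) 1?mulrDl; last by ring.
  by apply: lerD; [exact: fG | exact: apprP].
have fC : compl_set f by exact: approx_compl fapprox (cvg0M 3 (@harmonic0 R)).
apply/cvg_ex; exists (Compl fC); apply/cvg_ballP => e e0.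
have Re0 : 0 < complex.Re e by move: e0; rewrite ltcE => /andP[].
have eE : e = (complex.Re e)%:C by rewrite RRe_real// gtr0_real.
have /cvgr0Pnorm_lt/(_ _ Re0)[n _ hn] := cvg0M 3 (@harmonic0 R).
have {hn} := hn n (leqnn n); rewrite /= ger0_norm ?mulr_ge0 ?invr_ge0// => hn.
apply: filterS (GP n) => L; rewrite eE !compl_ballE => GL.
apply: le_lt_trans hn; rewrite -[Compl fC](subrK (G n)) -addrA.
apply: le_trans (snormD _ _ _) _.
rewrite (_ : 3 * _ = 2 * n.+1%:R^-1 + n.+1%:R^-1); last by ring.
apply: lerD (ltW GL); apply: le_compl => [|y]; first by rewrite mulr_ge0 ?invr_ge0.
by rewrite compl_valB; exact: fG.
Qed.

HB.instance Definition _ := Uniform_isComplete.Build compl_type compl_cauchy_cvg.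

Lemma cdot_bilinear :
  bilinear_for (GRing.Scale.Law.clone _ _ *%R _)
    (GRing.Scale.Law.clone _ _ (Num.conj \; *%R) _) cdot.
Proof.
split=> F c G L; first exact: cdot_lin.
by rewrite cdot_conj cdot_lin rmorphD rmorphM/= -!cdot_conj.
Qed.

HB.instance Definition _ := bilinear_isBilinear.Build R[i] compl_type compl_type
  R[i] _ _ cdot cdot_bilinear.

Lemma cdot_hermitian F G : cdot F G = (-1) ^+ false * Num.conj (cdot G F).
Proof. by rewrite expr0 mul1r cdot_conj. Qed.

HB.instance Definition _ := isHermitianSesquilinear.Build R[i] compl_type
  false Num.conj cdot cdot_hermitian.

Lemma cdot_gt0 F : F != 0 -> 0 < cdot F F.
Proof.
move=> F0; rewrite lt_def cdot_ge0 andbT; apply: contra_neq F0 => F0.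
by apply: compl_norm0; rewrite /compl_norm /snorm /= F0 /= sqrtr0.
Qed.

HB.instance Definition _ := isDotProduct.Build R[i] compl_type cdot cdot_gt0.

Lemma cdot_norm F : cdot F F = `|F| ^+ 2.
Proof.
by rewrite -[RHS]/((snorm cdot_semi F)%:C ^+ 2) -[LHS](snorm_sqr cdot_semi F) rmorphXn.
Qed.

Definition completion : hilbert R := @Hilbert R compl_type cdot cdot_norm.

End Completion.

(** * The GNS construction *)

Section CompletionMaps.
Variables (R : realType) (V : lmodType R[i]) (B : semi_dot V).

Lemma embed_linear : linear (embed B).
Proof. by move=> c x y; apply: compl_ext => z; rewrite compl_val_comb /= sdot_lin. Qed.

HB.instance Definition _ :=
  GRing.isLinear.Build R[i] V (compl_type B) *:%R (embed B) embed_linear.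

Lemma embed_dense (F : compl_type B) (e : R) : 0 < e ->
  exists x, snorm (cdot_semi B) (F - embed B x) < e.
Proof.
move=> e0; have /cvgr0Pnorm_lt/(_ _ e0)[n _ /(_ n (leqnn n))] := @harmonic0 R.
rewrite /= ger0_norm ?invr_ge0// => hn; exists (appr F n); apply: le_lt_trans hn.
apply: le_compl => [|y]; first by rewrite invr_ge0.
by rewrite compl_valB; exact: apprP.
Qed.

Variables (S T : V -> V) (C : R).
Hypothesis adj : forall x y, B (T x) y = B x (S y).
Hypothesis C0 : 0 <= C.
Hypothesis S_le : forall x, snorm B (S x) <= C * snorm B x.

Lemma precomp_approx f s : approx B f s (fun n => n.+1%:R^-1) ->
  approx B (f \o T) (S \o s) (fun n => C * n.+1%:R^-1).
Proof.
move=> fs n y /=; rewrite -adj; apply: le_trans (fs n _) _.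
rewrite (mulrC C) -mulrA ler_wpM2l ?invr_ge0//.
exact: (sdot_adjoint_le adj S_le).
Qed.

Lemma precomp_subproof (F : compl_type B) : compl_set B (compl_val F \o T).
Proof.
exact: approx_compl (precomp_approx (apprP F)) (cvg0M C (@harmonic0 R)).
Qed.

(** The extension of [S] to the completion, by <y, S F> = <T y, F>. *)
Definition precomp F : compl_type B := Compl (precomp_subproof F).

Lemma precomp_linear : linear precomp.
Proof.
move=> c F G; apply: compl_ext => y; rewrite [RHS]compl_val_comb.
exact: compl_val_comb.
Qed.

Lemma precomp_le F : snorm (cdot_semi B) (precomp F) <= C * snorm (cdot_semi B) F.
Proof.
apply: le_compl => [|y]; first by rewrite mulr_ge0 ?snorm_ge0.
apply: le_trans (compl_le F (T y)) _; rewrite mulrC mulrAC ler_wpM2r ?snorm_ge0//.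
exact: (sdot_adjoint_le adj S_le).
Qed.

Lemma cdot_precomp (F G : compl_type B) : 
  tends (fun n => compl_val G (S (appr F n))) (cdot G (precomp F)).
Proof.
exact: (@cdotP _ _ _ G (precomp F) _ _ (precomp_approx (apprP F))
  (cvg0M C (@harmonic0 R))).
Qed.

End CompletionMaps.

Section GNS.
Variables (R : realType) (q : R) (N : nat) (A : starAlg R) (u : 'M[A]_N).
Hypotheses (hq : 0 < q < 1) (hA : is_SUq q u).
Variables (psi : {scalar A}) (psi_gen : generating psi).
Implicit Types a b x y : A.

Lemma star1 : star 1 = 1 :> A.
Proof. by rewrite -[LHS]mul1r -[X in X * _](starK 1) -starM mul1r starK. Qed.

Definition centered x : A := x - counit A x *: 1.

Lemma counitZ c x : counit A (c *: x) = c * counit A x.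
Proof. exact: linearZ. Qed.

Lemma counit_centered x : counit A (centered x) = 0.
Proof. by rewrite rmorphB /= counitZ rmorph1 mulr1 subrr. Qed.

Lemma centered_id x : counit A x = 0 -> centered x = x.
Proof. by rewrite /centered => ->; rewrite scale0r subr0. Qed.

Lemma centered_comb c x y : centered (c *: x + y) = c *: centered x + centered y.
Proof.
rewrite /centered rmorphD /= counitZ scalerDl -scalerA scalerBr.
by rewrite opprD addrACA.
Qed.

(** Centering carries the form on [K1] over to the whole algebra, with the scalars as null vectors.
    The embedding into the completion is then itself the cocycle. *)
Definition gns_form x y : R[i] := psi (star (centered x) * centered y).

Lemma gns_form_lin x c y z : gns_form x (c *: y + z) = c * gns_form x y + gns_form x z.
Proof. by rewrite /gns_form centered_comb mulrDr -scalerAr linearP. Qed.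

Lemma gns_form_conj x y : gns_form x y = Num.conj (gns_form y x).
Proof. by have [herm _ _] := psi_gen; rewrite /gns_form -herm starM starK. Qed.

Lemma gns_form_ge0 x : 0 <= gns_form x x.
Proof. by have [_ _ pos] := psi_gen; apply: pos; exact: counit_centered. Qed.

Definition gns_semi : semi_dot A := SemiDot gns_form_lin gns_form_conj gns_form_ge0.

(** Left multiplication on [K1], transported by [centered]; 1 acts as the identity only up to null
    vectors. *)
Definition gns_mul a x := a * centered x.

Lemma centered_mul a x : centered (gns_mul a x) = gns_mul a x.
Proof. by rewrite centered_id// rmorphM /= counit_centered mulr0. Qed.

Lemma gns_mulM a b x : gns_mul (a * b) x = gns_mul a (gns_mul b x).
Proof. by rewrite {2}/gns_mul centered_mul mulrA. Qed.

Lemma gns_mul_comb c a b x : gns_mul (c *: a + b) x = c *: gns_mul a x + gns_mul b x.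
Proof. by rewrite /gns_mul mulrDl scalerAl. Qed.

Lemma gns_mulD a b x : gns_mul (a + b) x = gns_mul a x + gns_mul b x.
Proof. exact: mulrDl. Qed.

Lemma gns_mul1 x y : gns_semi y (gns_mul 1 x) = gns_semi y x.
Proof. by rewrite /= /gns_form centered_mul /gns_mul mul1r. Qed.

Lemma gns_mul_star a x y : gns_semi (gns_mul (star a) x) y = gns_semi x (gns_mul a y).
Proof. by rewrite /= /gns_form !centered_mul /gns_mul starM starK mulrA. Qed.

(** Unitarity bounds the generators by 1, and bounds persist under linear combinations and
    products. *)
Lemma gns_mul_bounded a :
  exists C : R, 0 <= C /\ forall x, snorm gns_semi (gns_mul a x) <= C * snorm gns_semi x.
Proof.
apply: (@suq_ind _ _ _ _ _ (fun a => exists C : R, 0 <= C /\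
  forall x, snorm gns_semi (gns_mul a x) <= C * snorm gns_semi x) hA) => {a}.
- exists 1; split=> // x; rewrite mul1r /snorm.
  by rewrite gns_mul1 sdot_conj gns_mul1 -sdot_conj.
- move=> c a b [C [C0 aC]] [D [D0 bD]]; exists (rnorm c * C + D).
  split=> [|x]; first by rewrite addr_ge0 ?mulr_ge0 ?rnorm_ge0.
  rewrite gns_mul_comb; apply: le_trans (snormD _ _ _) _; rewrite snormZ mulrDl.
  by apply: lerD => //; rewrite -mulrA ler_wpM2l ?rnorm_ge0.
- move=> a b [C [C0 aC]] [D [D0 bD]]; exists (C * D); split=> [|x]; first exact: mulr_ge0.
  by rewrite gns_mulM -mulrA; apply: le_trans (aC _) _; rewrite ler_wpM2l.
- move=> j k; exists 1; split=> // x; rewrite mul1r.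
  apply: (suq_contraction (T := gns_mul) hq hA).
  + by move=> y; rewrite gns_mul1.
  + exact: gns_mulM.
  + exact: gns_mulD.
  + exact: gns_mul_star.
Qed.

Definition gns_space : hilbert R := completion gns_semi.

Definition gns_bound a : R := sval (cid (gns_mul_bounded a)).

Lemma gns_bound_ge0 a : 0 <= gns_bound a.
Proof. exact: (svalP (cid (gns_mul_bounded a))).1. Qed.

Lemma gns_boundP a x : snorm gns_semi (gns_mul a x) <= gns_bound a * snorm gns_semi x.
Proof. exact: (svalP (cid (gns_mul_bounded a))).2. Qed.

Definition gns_op a (F : gns_space) : gns_space :=
  precomp (gns_mul_star a) (gns_boundP a) F.

Lemma gns_op_linear a : linear (gns_op a).
Proof. exact: precomp_linear. Qed.

HB.instance Definition _ a :=
  GRing.isLinear.Build R[i] gns_space gns_space *:%R (gns_op a) (gns_op_linear a).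

Lemma gns_op_cont a : continuous (gns_op a).
Proof.
apply: (@bounded_linear_continuous _ gns_space gns_space (gns_op a)).
apply/linear_boundedP; exists (gns_bound a)%:C; split.
  by rewrite complex_real.
move=> r Cr F.
have -> : `|gns_op a F| = (snorm (cdot_semi gns_semi) (gns_op a F))%:C by [].
have -> : `|F| = (snorm (cdot_semi gns_semi) F)%:C by [].
apply: (@le_trans _ _ ((gns_bound a)%:C * (snorm (cdot_semi gns_semi) F)%:C)).
  by rewrite -rmorphM lecR precomp_le ?gns_bound_ge0.
by rewrite ler_wpM2r ?ler0c ?snorm_ge0// ltW.
Qed.

Lemma gns_opP c a b F : gns_op (c *: a + b) F = c *: gns_op a F + gns_op b F.
Proof.
apply: compl_ext => y; rewrite compl_val_comb /= starD starZ gns_mul_comb.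
by rewrite (compl_conj_linear (compl_valP F)) conjCK.
Qed.

Lemma gns_op1 F : gns_op 1 F = F.
Proof.
apply: compl_ext => y; rewrite /=; apply/subr0_eq.
rewrite star1 -(compl_sub _ _ (compl_valP F)).
(* [F] vanishes on null vectors, and gns_mul 1 y - y is one. *)
apply: rnorm_le0; apply: le_trans (compl_le F _) _.
suff -> : snorm gns_semi (gns_mul 1 y - y) = 0 by rewrite mulr0.
by rewrite /snorm sdotBr gns_mul1 subrr sqrtr0.
Qed.

Lemma gns_opM a b F : gns_op (a * b) F = gns_op a (gns_op b F).
Proof. by apply: compl_ext => y /=; rewrite starM gns_mulM. Qed.

Lemma gns_op_star a (F G : gns_space) : ip (gns_op (star a) F) G = ip F (gns_op a G).
Proof.
rewrite ip_conj; have e1 := cdot_precomp (gns_mul_star (star a)) (gns_boundP (star a)) F G.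
have e2 := cdot_appr (gns_op a G) F.
have -> : ip G (gns_op (star a) F) = Num.conj (cdot G (gns_op (star a) F)).
  by rewrite -cdot_conj.
rewrite conjCK; exact: tends_unique e1 e2.
Qed.

Definition gns_rep : starRep A gns_space :=
  @StarRep R A gns_space (fun a => gns_op a) gns_op_cont gns_opP gns_op1 gns_opM gns_op_star.

Definition gns_eta : {linear A -> gns_space} :=
  (embed gns_semi : {linear A -> compl_type gns_semi}).

Lemma gns_cyclic : cyclic gns_eta.
Proof.
move=> O [F OF] oO; have /nbhs_ballP[e e0 FO] : nbhs F O by exact: open_nbhs_nbhs.
have Re0 : 0 < complex.Re e by move: e0; rewrite /= ltcE => /andP[].
have [x xF] := embed_dense F Re0; exists (embed gns_semi x); split; last by exists x.
apply: FO; have -> : e = (complex.Re e)%:C by rewrite RRe_real// gtr0_real.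
by rewrite (compl_ballE F _ (embed gns_semi x)).
Qed.

Lemma gns_triple : exists (H : hilbert R) (pi : starRep A H) (eta : {linear A -> H}),
  schurmann_triple pi eta psi /\ cyclic eta.
Proof.
exists gns_space, gns_rep, gns_eta.
split; last exact: gns_cyclic; split=> a b.
  apply: compl_ext => y; rewrite addrC compl_val_comb.
  rewrite [compl_val (embed _ a) y]/= [compl_val (gns_rep a _) y]/= [LHS]/=.
  rewrite -[RHS]/(counit A b * gns_semi y a + gns_semi (gns_mul (star a) y) b).
  (* The cocycle identity reduces to a (b - eps b) + eps b a = a b. *)
  rewrite gns_mul_star -sdotZr -sdotDr; congr (gns_semi y _).
  by rewrite /gns_mul /centered mulrBr -scalerAr mulr1 addrC subrK.
have -> : ip (embed gns_semi a : gns_space) (embed gns_semi b) = gns_form a b.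
  exact: cdot_embed.
have [_ psi1 _] := psi_gen.
have psiZ c x : psi (c *: x) = c * psi x by exact: linearZ.
rewrite /gns_form /centered -[- (counit A a *: 1)]scaleN1r starD !starZ star1.
rewrite (counit_star a) rmorphN rmorph1 scaleN1r mulrBl !mulrBr -!scalerAl -!scalerAr !mul1r mulr1.
rewrite !linearB !psiZ psi1 /=; ring.
Qed.

End GNS.

(** * Lévy-Khintchine decomposition *)

Section LevyKhintchine.
Variables (R : realType) (A : starAlg R).

(** A gaussian vector of the restriction is killed by [K1], so it lies in [gauss pi] and in its
    complement. *)
Lemma pi_NG_nongaussian (H : hilbert R) (pi : starRep A H) :
  completely_nongaussian (pi_NG pi).
Proof.
move=> S invS gS; apply/seteqP; split=> x; last by move=> ->; exact: (csub_lin S).1.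
move=> Sx; apply: val_inj; apply: (csub_ortho (S := gauss pi)); last exact: (csub_valP x).
move=> a Ka; have /(congr1 (@csub_val _ _ S)) := gS a Ka (csub_mk Sx).
by move=> /(congr1 (@csub_val _ _ (ortho (gauss pi)))).
Qed.

Lemma triple_generating (H : hilbert R) (pi : starRep A H) (eta : {linear A -> H})
    (psi : {scalar A}) :
  schurmann_triple pi eta psi -> (forall b, psi (star b) = Num.conj (psi b)) ->
  generating psi.
Proof.
move=> [eta_coc psiE] herm; split=> // [|b Kb].
  have := psiE 1 1; rewrite (cocycle1 eta_coc) ip0 star1 mulr1 rmorph1 mulr1 mul1r.
  by rewrite subrr sub0r => /esym/eqP; rewrite oppr_eq0 => /eqP.
have := psiE b b; rewrite (counit_star b) [counit A b]Kb conjC0 mulr0 mul0r !subr0 => <-.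
by rewrite ip_rnorm ler0c exprn_ge0 ?rnorm_ge0.
Qed.

(** [property_NC] does not assert that its functional is hermitian. Conjugating the triple identity
    shows that a |-> conj (psi (star a)) completes the same cocycle, hence so does the average with
    [psi]. *)
Lemma hermitian_triple (H : hilbert R) (pi : starRep A H) (eta : {linear A -> H})
    (psi : {scalar A}) : schurmann_triple pi eta psi ->
  exists2 psi' : {scalar A}, schurmann_triple pi eta psi' &
    forall b, psi' (star b) = Num.conj (psi' b).
Proof.
move=> [eta_coc psiE].
pose f a := 2^-1 * (psi a + Num.conj (psi (star a))).
have conj2 : Num.conj (2^-1 : R[i]) = 2^-1 by rewrite fmorphV rmorph_nat.
have f_lin : scalar f.
  move=> c a b; rewrite /f starD starZ !linearP !rmorphD !rmorphM /= conjCK; ring.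
pose g : {scalar A} := HB.pack f (GRing.isLinear.Build R[i] A R[i] *%R f f_lin).
exists g; last first.
  by move=> b; rewrite /= /f starK rmorphM rmorphD /= conj2 conjCK addrC.
split=> // a b; have e1 := psiE a b; have := congr1 Num.conj (psiE b a).
rewrite -ip_conj !rmorphB !rmorphM /= -!counit_star starK => e2.
rewrite -[LHS](_ : 2^-1 * (ip (eta a) (eta b) + ip (eta a) (eta b)) = _); last by field.
rewrite {1}e1 e2 /f starM !starK; ring.
Qed.

(** Property (NC) supplies [psiL] for the non-gaussian part of the cocycle. Inner products split
    along the two components, so the difference [psi - psiL] completes the gaussian part; both
    functionals are hermitian, hence generating. *)
Lemma LK_of_NC (nc : property_NC A) (gns : forall psi : {scalar A}, generating psi ->
    exists (H : hilbert R) (pi : starRep A H) (eta : {linear A -> H}),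
      schurmann_triple pi eta psi /\ cyclic eta) : property_LK A.
Proof.
move=> psi psi_gen; have [H [pi [eta [[eta_coc psiE] eta_cyc]]]] := gns psi psi_gen.
have [cocG cocNG] := cocycle_proj (@gauss_inv _ _ _ pi) (@nongauss_inv _ _ _ pi) eta_coc.
have [psi0 /hermitian_triple[psiL tripL hermL]] := nc _ _ (pi_NG_nongaussian (pi := pi)) _ cocNG.
pose psiG : {scalar A} := psi \- psiL.
have tripG : schurmann_triple (pi_G pi) (proj (gauss pi) \o eta) psiG.
  split=> // a b.
  have split_ip : ip (eta a) (eta b) = ip (proj (gauss pi) (eta a)) (proj (gauss pi) (eta b)) +
      ip (coproj (gauss pi) (eta a)) (coproj (gauss pi) (eta b)).
    by rewrite -ip_ortho_sum !proj_coproj.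
  have := psiE a b; rewrite split_ip; have [_ ->] := tripL.
  move=> e; rewrite -[LHS](addrK (psiL (star a * b) - psiL (star a) * counit A b -
    counit A (star a) * psiL b)) e /=; ring.
exists psiG, psiL; split.
- apply: (triple_generating tripG) => b; have [herm _ _] := psi_gen.
  by rewrite /= herm hermL rmorphB.
- exact: triple_generating tripL hermL.
- by move=> a; rewrite /= subrK.
exists H, pi, eta; split=> //.
exists (proj (gauss pi) \o eta), (coproj (gauss pi) \o eta); split=> // a.
by rewrite -[LHS](proj_coproj (gauss pi)).
Qed.

End LevyKhintchine.

Theorem corollary4p14 (R : realType) (N : nat) (q : R) (A : starAlg R)
  (u : 'M[A]_N) (hN : (2 <= N)%N) (hq : 0 < q < 1) (hA : is_SUq q u) :
  property_NC A /\ property_LK A.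
Proof.
have NC : property_NC A.
  move=> H pi ng eta eta_coc; apply: approximable_triple => //.
  exact: (approximable_of_nongaussian hq hA ng eta_coc).
split=> //; apply: LK_of_NC => // psi psi_gen; exact: (gns_triple hq hA psi_gen).
Qed.
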